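(* Let $X$ be a Banach space with a tight by support basis. Then for any isomorphic infinite dimensional subspaces $Y,Z\subset X$ we have $$\inf\{\|y-z\|:\ y\in Y,\ z\in Z,\ \|y\|=\|z\|=1\}=0.$$
   Context: Let $X$ be a Banach space with a (Schauder) basis $(e_i)$. The support of $x=\sum_i x_ie_i$ is $\operatorname{supp}x=\{i\in\mathbb{N}:x_i\neq0\}$; the support of a subspace is the union of the supports of its elements. ''Subspace'' means closed linear subspace. The basis $(e_i)$ is called tight by support if no two infinite dimensional subspaces of $X$ with disjoint supports are isomorphic. *)

(* Defs.v *)
From HB Require Import structures.
From mathcomp Require Import all_boot all_order all_algebra.
From mathcomp Require Import complex.
From mathcomp Require Import all_classical all_reals all_analysis.

Set Implicit Arguments.
Unset Strict Implicit.
Unset Printing Implicit Defensive.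

Import Order.TTheory GRing.Theory Num.Theory.
Import numFieldNormedType.Exports.

Local Open Scope classical_set_scope.
Local Open Scope ring_scope.

(* Norms of a normedModType over K take values in K itself; over R[i] they are
   nonnegative for the partial order of R[i], hence real. *)
Inductive real_or_complex : numFieldType -> Prop :=
| RealScalars (R : realType) : real_or_complex R
| ComplexScalars (R : realType) : real_or_complex R[i].

Section BasesAndSubspaces.
Context {K : numFieldType} {X : normedModType K}.
Implicit Types (e : nat -> X) (a : nat -> K) (x : X) (Y Z : set X).

Definition expansion e x a : Prop :=
  series (fun i => a i *: e i) @ \oo --> x.

Definition schauder_basis e : Prop := forall x, exists! a, expansion e x a.

(* The coordinate sequence of x; a junk value if x has no expansion. *)
Definition coordinates e x : nat -> K := xget (fun=> 0) [set a | expansion e x a].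

Definition supp e x : set nat := [set i | coordinates e x i != 0].

Definition subspace_supp e Y : set nat := \bigcup_(y in Y) supp e y.

Definition closed_subspace Y : Prop :=
  closed Y /\ GRing.submod_closed (mem Y).

Definition finite_dimensional Y : Prop :=
  exists (n : nat) (b : 'I_n -> X),
    Y = [set \sum_(i < n) c i *: b i | c in [set: 'I_n -> K]].

Definition infinite_dimensional Y : Prop := ~ finite_dimensional Y.

Definition linear_on Y (T : X -> X) : Prop :=
  forall (c : K) (u v : X), Y u -> Y v -> T (c *: u + v) = c *: T u + T v.

(* Linear homeomorphism between Y and Z for the induced norms. Only the values
   of T on Y and of S on Z are relevant. *)
Definition isomorphic Y Z : Prop :=
  exists T S : X -> X,
    [/\ set_fun Y Z T /\ set_fun Z Y S,
        {in Y, cancel T S} /\ {in Z, cancel S T},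
        linear_on Y T,
        {within Y, continuous T} &
        {within Z, continuous S}].

Definition tight_by_support e : Prop :=
  forall Y Z,
    closed_subspace Y -> closed_subspace Z ->
    infinite_dimensional Y -> infinite_dimensional Z ->
    subspace_supp e Y `&` subspace_supp e Z = set0 ->
    ~ isomorphic Y Z.

End BasesAndSubspaces.

(* Main.v *)
Require Import Defs.
From HB Require Import structures.
From mathcomp Require Import all_boot all_order all_algebra.
From mathcomp Require Import complex.
From mathcomp Require Import all_classical all_reals all_analysis.
From mathcomp Require Import lra ring.

Set Implicit Arguments.
Unset Strict Implicit.
Unset Printing Implicit Defensive.

Import Order.TTheory GRing.Theory Num.Theory.
Import numFieldNormedType.Exports.

Local Open Scope classical_set_scope.
Local Open Scope ring_scope.

(** A basis that is tight by support is unconditional. If the coordinate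
    projections [mask A] were unbounded, there would be blocks [x], as far out as
    desired, of tiny norm compared to [mask A x]; the sequences of the vectors
    [mask A x] and [mask A x - x] would then be small perturbations of each other,
    hence equivalent, although their supports are disjoint ([mask_bounded]). So
    diagonal operators with bounded coefficients are bounded
    ([multiplier_bounded]).

    Let [T] be an isomorphism from [Y] onto [Z]. Up to a small perturbation there
    is a block sequence of pairs [(u_j, v_j)] along which [T] maps [u_j] to [v_j]
    ([approximating_blocks]). Color a coordinate [i] of the [j]-th block by the
    approximate value of [v_j(i) / u_j(i)], with finitely many colors, one of them
    for all large ratios. For each color, the projection of the first (or the
    second) component onto the coordinates of that color is either bounded below
    on some infinite dimensional subspace, or as small as desired on one
    ([seminorm_dichotomy]); after finitely many passages to a subspace, each of
    these projections falls into one of the two cases. If the first components are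
    bounded below at a color [c] and the second components at a color [c'], then
    [c = c'], for otherwise the projections would be isomorphic subspaces with
    disjoint supports ([masks_not_both_below]). So there is a single color at which
    nearly all of both components lives. It is not the color of the large ratios,
    because the components have comparable norms, so that [v] is close to [lam u]
    on the surviving subspace, where [lam] is the value of the color
    ([block_seq_almost_proportional]). Hence [T y] is as close as desired to
    [lam y], relatively to the norm of [y], for some nonzero [y] in [Y]
    ([almost_eigenvector]), and normalizing [lam y] and [T y] gives unit vectors of
    [Y] and [Z] close to each other.

    Isomorphic subspaces are handled through their graphs, as sets of pairs, and
    most of the work is done with finitely supported vectors, represented by
    polynomials: the coefficients are the coordinates, and closures are taken only
    when tightness is invoked ([tight_by_support_poly]). The uniform boundedness of
    the partial sums of the basis is [partial_sum_bounded]. *)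

(** * Real-valued moduli and seminorms *)

(** Over [R[i]] a norm takes values in [R[i]], whose order is partial. A modulus
    carries norms to the totally ordered field [R]; [modulus_net] is the
    total boundedness of the unit disc, from which finite colorings of ratios are
    obtained. *)
Record real_modulus (R : realType) (K : numFieldType) := RealModulus {
  of_real : {rmorphism R -> K};
  modulus : K -> R;
  of_real_le : forall a b, (of_real a <= of_real b) = (a <= b);
  of_realE : forall c, `|c| = of_real (modulus c);
  modulus_net : forall eps : R, 0 < eps ->
    exists s : seq K, forall c, modulus c <= 1 ->
      exists2 l, l \in s & modulus (c - l) <= eps;
  modulus_complete : forall u : nat -> K,
    (forall eps : R, 0 < eps -> exists m, forall i j, (m <= i)%N -> (m <= j)%N ->
      modulus (u i - u j) < eps) ->
    exists l, forall eps : R, 0 < eps ->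
      exists m, forall i, (m <= i)%N -> modulus (u i - l) < eps }.

Lemma half_expn_lt (R : realType) (b eps : R) : 0 < eps ->
  exists r, b * (2^-1) ^+ r < eps.
Proof.
move=> e0; have [b0|b0] := leP b 0.
  by exists 0%N; rewrite expr0 mulr1 (le_lt_trans b0).
exists (Num.truncn (b / eps)).+1; set r := _.+1.
rewrite exprVn ltr_pdivrMr ?exprn_gt0// mulrC -ltr_pdivrMr//.
apply: lt_le_trans (truncnS_gt _) _.
by rewrite -natrX ler_nat -/r ltnW// ltn_expl.
Qed.

Lemma le_half_expn (R : realType) (x y b : R) :
  (forall r, x <= y + b * (2^-1) ^+ r) -> x <= y.
Proof.
move=> h; apply/ler_addgt0Pr => eps e0.
have [r re] := half_expn_lt b e0.
by apply: le_trans (h r) _; rewrite lerD2l ltW.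
Qed.

Section Modulus.
Context {R : realType} {K : numFieldType} (M : real_modulus R K).
Local Notation nu := (modulus M).
Local Notation iota := (of_real M).

Lemma of_real_inj : injective iota. Proof. exact: fmorph_inj. Qed.

Lemma of_real_lt a b : (iota a < iota b) = (a < b).
Proof. by rewrite !lt_def of_real_le (inj_eq of_real_inj). Qed.

Lemma modulus_ge0 c : 0 <= nu c.
Proof. by rewrite -(of_real_le M) rmorph0 -of_realE. Qed.

Lemma modulus0 : nu 0 = 0.
Proof. by apply: of_real_inj; rewrite -of_realE normr0 rmorph0. Qed.

Lemma modulus_eq0 c : (nu c == 0) = (c == 0).
Proof. by rewrite -(inj_eq of_real_inj) -of_realE rmorph0 normr_eq0. Qed.

Lemma modulusM : {morph nu : a b / a * b}.
Proof. by move=> a b; apply: of_real_inj; rewrite rmorphM -!of_realE normrM. Qed.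

Lemma modulusV : {morph nu : a / a^-1}.
Proof. by move=> a; apply: of_real_inj; rewrite fmorphV -!of_realE normfV. Qed.

Lemma modulusN c : nu (- c) = nu c.
Proof. by apply: of_real_inj; rewrite -!of_realE normrN. Qed.

Lemma modulusD a b : nu (a + b) <= nu a + nu b.
Proof. by rewrite -(of_real_le M) rmorphD -!of_realE ler_normD. Qed.

Lemma modulus_of_real a : 0 <= a -> nu (iota a) = a.
Proof.
by move=> a0; apply: of_real_inj; rewrite -of_realE ger0_norm// -(rmorph0 iota)
  of_real_le.
Qed.

Lemma modulus_nat m : nu m%:R = m%:R.
Proof. by rewrite -(rmorph_nat iota) modulus_of_real. Qed.

Lemma modulus_net_disc (r eps : R) : 0 < r -> 0 < eps ->
  exists s : seq K, forall c, nu c <= r -> exists2 l, l \in s & nu (c - l) <= eps.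
Proof.
move=> r0 e0; have [|s sP] := @modulus_net _ _ M (eps / r); first exact: divr_gt0.
exists [seq iota r * l | l <- s] => c cr.
have ir0 : iota r != 0 by rewrite fmorph_eq0 gt_eqF.
have [|l ls lc] := sP (c / iota r).
  by rewrite modulusM modulusV modulus_of_real ?(ltW r0)// ler_pdivrMr ?mul1r.
exists (iota r * l); first exact: map_f.
have -> : c - iota r * l = (c / iota r - l) * iota r by field.
by rewrite modulusM modulus_of_real ?(ltW r0)// -ler_pdivlMr.
Qed.

Definition seminorm (V : lmodType K) (f : V -> R) : Prop :=
  (forall x y, f (x + y) <= f x + f y) /\ (forall c x, f (c *: x) = nu c * f x).

Definition linear_set (V : lmodType K) (G : set V) : Prop :=
  G 0 /\ forall c x y, G x -> G y -> G (c *: x + y).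

Section Seminorm.
Context {V : lmodType K} {f : V -> R} (fP : seminorm f).

Lemma seminormD x y : f (x + y) <= f x + f y. Proof. exact: fP.1. Qed.

Lemma seminormZ c x : f (c *: x) = nu c * f x. Proof. exact: fP.2. Qed.

Lemma seminorm0 : f 0 = 0.
Proof. by rewrite -[0](scale0r 0) seminormZ modulus0 mul0r. Qed.

Lemma seminormN x : f (- x) = f x.
Proof. by rewrite -scaleN1r seminormZ modulusN (modulus_nat 1) mul1r. Qed.

Lemma seminormB x y : f (x - y) <= f x + f y.
Proof. by rewrite -(seminormN y); apply: seminormD. Qed.

Lemma seminormBC x y : f (x - y) = f (y - x).
Proof. by rewrite -seminormN opprB. Qed.

Lemma seminorm_ge0 x : 0 <= f x.
Proof. by have := seminormB x x; rewrite subrr seminorm0; lra. Qed.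

Lemma seminorm_sum (I : Type) (r : seq I) (P : pred I) (F : I -> V) :
  f (\sum_(i <- r | P i) F i) <= \sum_(i <- r | P i) f (F i).
Proof.
elim/big_ind2 : _ => //; first by rewrite seminorm0.
move=> x1 x2 y1 y2 h1 h2; apply: le_trans (seminormD _ _) _; exact: lerD.
Qed.

Lemma seminorm_distl x y : f x <= f (x - y) + f y.
Proof. by have := seminormD (x - y) y; rewrite subrK. Qed.

End Seminorm.

Section LinearSet.
Context {V : lmodType K} {G : set V} (GP : linear_set G).

Lemma linear_set0 : G 0. Proof. exact: GP.1. Qed.

Lemma linear_setZ c x : G x -> G (c *: x).
Proof. by move=> Gx; rewrite -[_ *: _]addr0; apply: GP.2 => //; apply: GP.1. Qed.

Lemma linear_setD x y : G x -> G y -> G (x + y).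
Proof. by move=> Gx Gy; rewrite -[x]scale1r; apply: GP.2. Qed.

Lemma linear_setB x y : G x -> G y -> G (x - y).
Proof.
move=> Gx Gy; apply: linear_setD => //.
by rewrite -scaleN1r; apply: linear_setZ.
Qed.

Lemma linear_set_sum (I : Type) (r : seq I) (P : pred I) (F : I -> V) :
  (forall i, P i -> G (F i)) -> G (\sum_(i <- r | P i) F i).
Proof.
move=> h; elim/big_ind : _ => //; first exact: linear_set0.
exact: linear_setD.
Qed.

End LinearSet.

End Modulus.

(** * Block sequences of pairs of finitely supported vectors *)

Section Blocks.
Context {R : realType} {K : numFieldType} (M : real_modulus R K).
Local Notation nu := (modulus M).
Local Notation E := {poly K}.
Implicit Types (p q : E) (g h x : E * E) (G : set (E * E)) (f : E -> R).

Definition block (a b : nat) p : Prop :=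
  forall i, (i < a)%N || (b <= i)%N -> p`_i = 0.

Definition block_seq (k : nat -> nat) (u : nat -> E * E) : Prop :=
  forall j, [/\ (k j < k j.+1)%N, block (k j) (k j.+1) (u j).1,
    block (k j) (k j.+1) (u j).2 & (u j).1 != 0].

Definition lin_span (u : nat -> E * E) : set (E * E) :=
  [set x | exists m (c : nat -> K), x = \sum_(j < m) c j *: u j].

(** A form of infinite dimensionality that survives the passage to the vectors
    vanishing at the first coordinates, and that block sequences are extracted from. *)
Definition rich G : Prop := forall k, exists g,
  [/\ G g, g.1 != 0, take_poly k g.1 = 0 & take_poly k g.2 = 0].

(** A linear set of pairs with comparable components is the graph of an isomorphism
    between its two projections. *)
Definition comparable_on f (D : R) G : Prop :=
  forall g, G g -> f g.1 <= D * f g.2 /\ f g.2 <= D * f g.1.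

Lemma take_poly_eq0 k p : take_poly k p = 0 <-> (forall i, (i < k)%N -> p`_i = 0).
Proof.
split=> [h i ik|h]; last first.
  by apply/polyP => i; rewrite coef_take_poly coef0; case: ifP => // /h.
by move/(congr1 (fun q : E => q`_i)): h; rewrite coef_take_poly ik coef0.
Qed.

Lemma block_seq_mono k u : block_seq k u -> {homo k : i j / (i <= j)%N}.
Proof. by move=> h; apply: homo_leq => // [|i]; [exact: leq_trans|case: (h i)=> /ltnW]. Qed.

Lemma block_seq_id k u : block_seq k u -> forall j, (j <= k j)%N.
Proof. by move=> h; elim=> // j /leq_ltn_trans; apply; case: (h j). Qed.

Lemma block_seq_cover k u : block_seq k u -> forall i,
  (i < k 0)%N \/ exists j, (k j <= i < k j.+1)%N.
Proof.
move=> kP i; case: ltnP => [|k0i]; [by left|right].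
have exk : exists j, (i < k j)%N by exists i.+1; exact: (block_seq_id kP i.+1).
case: (ex_minnP exk) => -[|j] ij jmin; first by rewrite ltnNge k0i in ij.
exists j; rewrite ij andbT leqNgt; apply/negP => /jmin.
by rewrite ltnn.
Qed.

Lemma sum1E m (c : nat -> K) u : (\sum_(j < m) c j *: u j : E * E).1 =
  \sum_(j < m) c j *: (u j).1.
Proof. by elim/big_rec2 : _ => //= i y1 y2 _ <-. Qed.

Lemma sum2E m (c : nat -> K) u : (\sum_(j < m) c j *: u j : E * E).2 =
  \sum_(j < m) c j *: (u j).2.
Proof. by elim/big_rec2 : _ => //= i y1 y2 _ <-. Qed.

Lemma coef_block_sum k (v : nat -> E) m (c : nat -> K) j i :
    {homo k : i j / (i <= j)%N} -> (forall j, block (k j) (k j.+1) (v j)) ->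
    (k j <= i < k j.+1)%N ->
  (\sum_(l < m) c l *: v l)`_i = if (j < m)%N then c j * (v j)`_i else 0.
Proof.
move=> kh vP /andP[ji ij]; rewrite coef_sum.
have z l : l != j -> (c l *: v l)`_i = 0.
  move=> lj; rewrite coefZ (vP l) ?mulr0//.
  have [jl|jl|/eqP] := ltngtP l j; last by rewrite (negbTE lj).
  - by rewrite (leq_trans (kh _ _ jl) ji) orbT.
  - by rewrite (leq_trans ij (kh _ _ jl)).
case: ltnP => [jm|mj].
  rewrite (bigD1 (Ordinal jm)) //= big1 ?addr0 ?coefZ// => l lj.
  by apply: z; apply: contra lj => /eqP e; apply/eqP/val_inj.
by apply: big1 => l _; apply: z; rewrite ltn_eqF// (leq_trans (ltn_ord l)).
Qed.

Lemma coef_block_sum0 k (v : nat -> E) m (c : nat -> K) i :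
    {homo k : i j / (i <= j)%N} -> (forall j, block (k j) (k j.+1) (v j)) ->
    (i < k 0)%N ->
  (\sum_(l < m) c l *: v l)`_i = 0.
Proof.
move=> kh vP ik; rewrite coef_sum big1 // => l _; rewrite coefZ (vP l) ?mulr0//.
by rewrite (leq_trans ik) // kh.
Qed.

Lemma lin_span_linear u : linear_set (lin_span u).
Proof.
split; first by exists 0%N, (fun=> 0); rewrite big_ord0.
move=> a _ _ [m1 [c1 ->]] [m2 [c2 ->]].
have ext m (c : nat -> K) r : (m <= r)%N -> \sum_(j < m) c j *: u j =
    \sum_(j < r) (if (j < m)%N then c j else 0) *: u j.
  move=> mr; rewrite (big_ord_widen _ (fun j => c j *: u j) mr) big_mkcond.
  by apply: eq_bigr => j _; case: ifP => //; rewrite scale0r.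
rewrite (ext m1 c1 _ (leq_maxl m1 m2)) (ext m2 c2 _ (leq_maxr m1 m2)).
exists (maxn m1 m2), (fun j => a * (if (j < m1)%N then c1 j else 0)
  + (if (j < m2)%N then c2 j else 0)).
rewrite scaler_sumr -big_split; apply: eq_bigr => j _.
by rewrite scalerA scalerDl.
Qed.

Lemma lin_span_mem u j : lin_span u (u j).
Proof.
exists j.+1, (fun l => (l == j)%:R).
rewrite big_ord_recr /= eqxx scale1r big1 ?add0r// => l _.
by rewrite ltn_eqF// scale0r.
Qed.

Lemma lin_span_sub u G : linear_set G -> (forall j, G (u j)) -> lin_span u `<=` G.
Proof.
move=> GP uG _ [m [c ->]]; apply: linear_set_sum => // j _; exact: linear_setZ.
Qed.

(** The [l]-th block lies beyond the first [l] coordinates. *)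
Lemma lin_span_rich k u : block_seq k u -> rich (lin_span u).
Proof.
move=> uP l; exists (u l); have [_ b1 b2 nz] := uP l.
split=> //; first exact: lin_span_mem.
- by apply/take_poly_eq0 => i il; rewrite b1// (leq_trans il (block_seq_id uP l)).
- by apply/take_poly_eq0 => i il; rewrite b2// (leq_trans il (block_seq_id uP l)).
Qed.

(** Blocks are chosen recursively, each one beyond the support of the previous one. *)
Lemma block_seq_exists (Q : nat -> nat -> R -> E * E -> Prop) (d : nat -> R) :
    (forall j, 0 < d j) ->
    (forall a eps, 0 < eps -> exists b g, [/\ (a < b)%N, block a b g.1, block a b g.2,
      g.1 != 0 & Q a b eps g]) ->
  exists k u, block_seq k u /\ forall j, Q (k j) (k j.+1) (d j) (u j).
Proof.
move=> d0 step.
have /choice [F FP] : forall aj : nat * nat, exists bg : nat * (E * E),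
    [/\ (aj.1 < bg.1)%N, block aj.1 bg.1 bg.2.1, block aj.1 bg.1 bg.2.2,
      bg.2.1 != 0 & Q aj.1 bg.1 (d aj.2) bg.2].
  by move=> [a j]; have [b [g gP]] := step a (d j) (d0 j); exists (b, g).
pose k := fix k j := if j is l.+1 then (F (k l, l)).1 else 0%N.
exists k, (fun j => (F (k j, j)).2).
by split=> j; have [h1 h2 h3 h4 h5] := FP (k j, j).
Qed.

Section Estimates.
Context {n : E -> R} (nP : seminorm M n) (C : R) (C0 : 0 < C)
  (n_take : forall k p, n (take_poly k p) <= C * n p).
Context {k : nat -> nat} {u : nat -> E * E} (uP : block_seq k u).

(** The [j]-th term of the sum is a difference of two of its truncations. *)
Lemma block_coef_le m (c : nat -> K) j : (j < m)%N ->
  nu (c j) * n (u j).1 <= 2 * C * n (\sum_(l < m) c l *: u l).1.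
Proof.
move=> jm; set x := (\sum_(l < m) _).1.
have kh := block_seq_mono uP.
have vP l : block (k l) (k l.+1) (u l).1 by case: (uP l).
have -> : nu (c j) * n (u j).1 = n (take_poly (k j.+1) x - take_poly (k j) x).
  rewrite -(seminormZ nP); congr (n _); apply/polyP => i.
  rewrite coefB !coef_take_poly coefZ.
  have [ij|ji] := ltnP i (k j).
    by rewrite (leq_trans ij (kh _ _ (leqnSn j))) subrr vP ?mulr0// ij.
  rewrite subr0; case: ltnP => ij; last by rewrite vP ?mulr0// ij orbT.
  have := @coef_block_sum k (fun l => (u l).1) m c j i kh vP.
  by rewrite /x sum1E ji ij jm => ->.
have := seminormB nP (take_poly (k j.+1) x) (take_poly (k j) x).
have := n_take (k j.+1) x; have := n_take (k j) x; lra.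
Qed.

(** The factor [2 * C] is the bound for the terms of a block sum, and the powers of
    1/2 sum up to at most 1. *)
Lemma block_sum_le m (c : nat -> K) (r : nat -> R) (eps : R) : 0 <= eps ->
    (forall j, r j <= eps / (2 * C) * (2^-1) ^+ j.+1 * n (u j).1) ->
  \sum_(j < m) nu (c j) * r j <= eps * n (\sum_(l < m) c l *: u l).1.
Proof.
move=> e0 rP; set N := n _.
have N0 : 0 <= N := seminorm_ge0 nP _.
have half0 j : 0 <= (2^-1 : R) ^+ j by rewrite exprn_ge0// invr_ge0.
have le1 (j : 'I_m) : nu (c j) * r j <= eps * N * (2^-1) ^+ j.+1.
  have := @block_coef_le m c j (ltn_ord j); rewrite -/N => h.
  have := ler_wpM2l (modulus_ge0 M (c j)) (rP j); move=> /le_trans; apply.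
  set a := _ ^+ _; rewrite [leLHS](_ : _ = eps / (2 * C) * a * (nu (c j) * n (u j).1)); last by ring.
  rewrite [leRHS](_ : _ = eps / (2 * C) * a * (2 * C * N)); last by field; rewrite gt_eqF.
  apply: ler_wpM2l => //; apply: mulr_ge0; last exact: half0.
  by apply: divr_ge0 => //; rewrite mulr_ge0 ?(ltW C0).
apply: le_trans (ler_sum _ (fun j _ => le1 j)) _.
rewrite -mulr_sumr -[leRHS]mulr1; apply: ler_wpM2l; first exact: mulr_ge0.
suff -> : \sum_(j < m) (2^-1 : R) ^+ j.+1 = 1 - (2^-1) ^+ m.
  by rewrite gerBl.
elim: m {N N0 le1} => [|m IH]; first by rewrite big_ord0 expr0 subrr.
by rewrite big_ord_recr /= IH exprS; field.
Qed.

(** A seminorm that decays fast along a block sequence is small on its whole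
    span, since the coefficients of a vector are controlled by its norm. *)
Lemma block_seminorm_le (phi : E * E -> R) (eps : R) : seminorm M phi -> 0 <= eps ->
    (forall j, phi (u j) <= eps / (2 * C) * (2^-1) ^+ j.+1 * n (u j).1) ->
  forall x, lin_span u x -> phi x <= eps * n x.1.
Proof.
move=> phiP e0 h _ [m [c ->]].
apply: le_trans (seminorm_sum phiP _ _ _) _.
under eq_bigr => j _ do rewrite (seminormZ phiP).
exact: (@block_sum_le m c (fun j => phi (u j))) h.
Qed.

End Estimates.

Lemma weight_gt0 (eps C : R) j : 0 < eps -> 0 < C -> 0 < eps / (2 * C) * (2^-1) ^+ j.+1.
Proof. by move=> e0 C0; rewrite mulr_gt0 ?divr_gt0 ?mulr_gt0// exprn_gt0// invr_gt0. Qed.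

End Blocks.

(** * Tightness by support for finitely supported vectors *)

Section Mask.
Context {K : numFieldType}.
Implicit Types (p : {poly K}) (A : pred nat).

Definition mask A p : {poly K} := \poly_(i < size p) (if A i then p`_i else 0).

Lemma coef_mask A p i : (mask A p)`_i = if A i then p`_i else 0.
Proof.
rewrite coef_poly; case: ltnP => // ip; case: ifP => // _.
by rewrite nth_default.
Qed.

Lemma mask_linear A c p q : mask A (c *: p + q) = c *: mask A p + mask A q.
Proof.
by apply/polyP => i; rewrite !(coefD, coefZ, coef_mask); case: ifP; rewrite // mulr0 addr0.
Qed.

Lemma maskD A : {morph mask A : p q / p + q}.
Proof. by move=> p q; rewrite -[p]scale1r mask_linear !scale1r. Qed.

Lemma maskZ A c p : mask A (c *: p) = c *: mask A p.
Proof. by apply/polyP => i; rewrite !(coefZ, coef_mask); case: ifP; rewrite // mulr0. Qed.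

Lemma mask_take_eq0 A k p : take_poly k p = 0 -> take_poly k (mask A p) = 0.
Proof.
move/take_poly_eq0 => h; apply/take_poly_eq0 => i ik.
by rewrite coef_mask h// if_same.
Qed.

Lemma sum_mask (col : nat -> nat) m p : (forall i, (col i < m)%N) ->
  \sum_(c < m) mask (fun i => col i == c) p = p.
Proof.
move=> colm; apply/polyP => i; rewrite coef_sum (bigD1 (Ordinal (colm i))) //=.
rewrite coef_mask eqxx big1 ?addr0// => c /eqP ci.
by rewrite coef_mask; case: eqP => // e; case: ci; apply/val_inj.
Qed.

End Mask.

Section TightPoly.
Context {R : realType} {K : numFieldType} (M : real_modulus R K).
Local Notation nu := (modulus M).
Local Notation iota := (of_real M).
Local Notation E := {poly K}.
Implicit Types (p q : E) (g h x : E * E) (G : set (E * E)).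

(** Tightness by support in terms of graphs of isomorphisms. No closures are taken,
    so that it applies to spans of explicit sequences. *)
Definition tight_poly (n : E -> R) : Prop := forall (D : R) G,
  linear_set G -> rich G -> comparable_on n D G ->
  (forall g h i, G g -> G h -> g.1`_i = 0 \/ h.2`_i = 0) -> False.

Context {n : E -> R} (nP : seminorm M n) (n_eq0 : forall p, n p = 0 -> p = 0)
  {C : R} (C0 : 0 < C) (n_take : forall k p, n (take_poly k p) <= C * n p).

Context (tight : tight_poly n).

Lemma seminorm_gt0 p : p != 0 -> 0 < n p.
Proof.
move=> p0; rewrite lt_def (seminorm_ge0 nP) andbT.
by apply: contra p0 => /eqP/n_eq0/eqP.
Qed.

Lemma lin_span_coef k u x : block_seq k u -> lin_span u x ->
  (forall i, (i < k 0)%N -> x.1`_i = 0 /\ x.2`_i = 0) /\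
  forall j, exists c, forall i, (k j <= i < k j.+1)%N ->
    x.1`_i = c * (u j).1`_i /\ x.2`_i = c * (u j).2`_i.
Proof.
move=> uP [m [c ->]]; have kh := block_seq_mono uP.
have v1 l : block (k l) (k l.+1) (u l).1 by case: (uP l).
have v2 l : block (k l) (k l.+1) (u l).2 by case: (uP l).
split=> [i ik|j].
  by rewrite sum1E sum2E (coef_block_sum0 m c kh v1)// (coef_block_sum0 m c kh v2).
exists (if (j < m)%N then c j else 0) => i ij.
rewrite sum1E sum2E (coef_block_sum m c kh v1 ij) (coef_block_sum m c kh v2 ij).
by case: ifP => _; rewrite ?mul0r.
Qed.

Lemma coef_norm_le p i : nu p`_i * n 'X^i <= 2 * C * n p.
Proof.
rewrite -(seminormZ nP).
have -> : p`_i *: 'X^i = take_poly i.+1 p - take_poly i p.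
  apply/polyP => l; rewrite coefB !coef_take_poly coefZ coefXn ltnS.
  by case: ltngtP => [li|li|->]; rewrite /= ?mulr0 ?mulr1 ?subrr ?subr0.
have := seminormB nP (take_poly i.+1 p) (take_poly i p).
have := n_take i.+1 p; have := n_take i p; lra.
Qed.

Lemma mask_take_le A a p : n (mask A (take_poly a p)) <= 2 * C * a%:R * n p.
Proof.
have -> : mask A (take_poly a p) = \sum_(i < a) (if A i then p`_i else 0) *: 'X^i.
  rewrite -[RHS](@poly_def _ a (fun i => if A i then p`_i else 0)).
  apply/polyP => i; rewrite coef_mask coef_poly coef_take_poly.
  by case: ifP; case: ifP.
apply: le_trans (seminorm_sum nP _ _ _) _.
rewrite [leRHS](_ : _ = \sum_(i < a) 2 * C * n p); last first.
  by rewrite sumr_const card_ord -mulr_natr; ring.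
apply: ler_sum => i _; rewrite (seminormZ nP).
case: ifP => _; first exact: coef_norm_le.
by rewrite (modulus0 M) mul0r !mulr_ge0 ?(ltW C0) ?(seminorm_ge0 nP).
Qed.

(** If coordinate projections were unbounded, there would be blocks [x] of tiny
    norm compared to some [mask A x]; then [mask A x] and [mask A x - x] are
    disjointly supported and nearly equal, so such blocks span two isomorphic
    subspaces with disjoint supports. *)
Lemma mask_bounded : exists2 B, 0 < B & forall A p, n (mask A p) <= B * n p.
Proof.
apply: contrapT => nB.
have big B : 0 < B -> exists A p, B * n p < n (mask A p).
  move=> B0; apply: contrapT => h; apply: nB; exists B => // A p.
  by rewrite leNgt; apply/negP => lt; apply: h; exists A, p.
pose Q (a b : nat) (eps : R) g := n (g.1 - g.2) <= eps * n g.1 /\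
  forall i, g.1`_i = 0 \/ g.2`_i = 0.
pose d (j : nat) : R := 2^-1 / (2 * C) * (2^-1) ^+ j.+1.
have [||k [u [uP uQ]]] := @block_seq_exists _ _ Q d.
- by move=> j; apply: weight_gt0; rewrite ?invr_gt0.
- move=> a eps e0.
  (* Truncating changes the norm of [mask A p] by at most [2 * C * a] times that of
     [p]; the constant leaves a tail on which the mask is still badly bounded. *)
  have [|A [p pA]] := big (2 * C * a%:R + (1 + C) / eps).
    by rewrite ltr_wpDl ?divr_gt0 ?addr_gt0// !mulr_ge0// ltW.
  pose y := p - take_poly a p; pose v := mask A y.
  have yE : y = p + (-1) *: take_poly a p by rewrite scaleN1r.
  have ya i : (i < a)%N -> y`_i = 0 by move=> ia; rewrite coefB coef_take_poly ia subrr.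
  have vE : v = mask A p - mask A (take_poly a p).
    by rewrite /v yE maskD maskZ scaleN1r.
  have np0 := seminorm_ge0 nP p.
  have ny : n y <= (1 + C) * n p.
    by have := seminormB nP p (take_poly a p); have := n_take a p; rewrite -/y; lra.
  have nv : (1 + C) / eps * n p < n v.
    have := seminorm_distl nP (mask A p) (mask A (take_poly a p)).
    have := mask_take_le A a p; rewrite -vE; move: pA; rewrite mulrDl; lra.
  exists (maxn (size y) a.+1), (v, v - y); split => /=.
  - by rewrite leq_max ltnSn orbT.
  - move=> i /orP[ia|]; first by rewrite coef_mask ya ?if_same.
    by rewrite geq_max => /andP[yi _]; rewrite coef_mask nth_default ?if_same.
  - move=> i /orP[ia|]; first by rewrite coefB coef_mask ya ?if_same ?subrr.
    rewrite geq_max => /andP[yi _].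
    by rewrite coefB coef_mask nth_default ?if_same ?subrr.
  - apply: contraTN nv => /eqP ->; rewrite (seminorm0 nP) -leNgt.
    by rewrite mulr_ge0 ?divr_ge0 ?addr_ge0// ltW.
  - split => /=.
      rewrite opprB addrC subrK; apply: le_trans ny _.
      by move/ltW: nv; rewrite mulrAC ler_pdivrMr// [eps * _]mulrC.
    by move=> i; rewrite coefB coef_mask; case: ifP; [right; rewrite subrr|left].
have small : forall x, lin_span u x -> n (x.1 - x.2) <= 2^-1 * n x.1.
  apply: (block_seminorm_le nP C0 n_take uP (phi := fun x => n (x.1 - x.2))) => [||j].
  - split=> [x y|c x] /=; last by rewrite -scalerBr (seminormZ nP).
    by rewrite opprD addrACA (seminormD nP).
  - by rewrite invr_ge0.
  - exact: (uQ j).1.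
apply: (tight (D := 2) (lin_span_linear u) (lin_span_rich uP)).
  move=> g gu; have := small g gu.
  have := seminorm_distl nP g.1 g.2; have := seminorm_distl nP g.2 g.1.
  rewrite (seminormBC nP g.2); have := seminorm_ge0 nP g.1; lra.
move=> g h i gu hu; have [g0 gj] := lin_span_coef uP gu.
have [h0 hj] := lin_span_coef uP hu.
have [/g0[]|[j ij]] := block_seq_cover uP i; first by left.
have [c /(_ i ij)[-> _]] := gj j; have [c' /(_ i ij)[_ ->]] := hj j.
by case: ((uQ j).2 i) => ->; rewrite mulr0; [left|right].
Qed.

(** Multipliers bounded by 1 are reduced to masks by rounding them to a finite
    1/2-net of the unit disc: the error is a multiplier bounded by 1/2, so that
    any a priori bound for multipliers can be halved up to a fixed constant. *)
Lemma multiplier_bounded : exists2 B, 0 < B & forall p q,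
  (forall i, nu q`_i <= nu p`_i) -> n q <= B * n p.
Proof.
have [B B0 maskB] := mask_bounded.
have [|s sP] := modulus_net M (eps := 2^-1); first by rewrite invr_gt0.
pose L := \sum_(c < size s) nu s`_c * B.
have L0 : 0 <= L by apply: sumr_ge0 => c _; rewrite mulr_ge0 ?modulus_ge0// ltW.
exists (2 * L + 1); first by rewrite ltr_wpDl// mulr_ge0.
move=> p q0 q0p; have np := seminorm_ge0 nP p.
suff : n q0 <= 2 * (L * n p) by move: np; lra.
pose H b := forall q, (forall i, nu q`_i <= nu p`_i) -> n q <= b.
have Hhalf b : H b -> H (L * n p + b / 2).
  move=> Hb q qp.
  have /choice[col colP] : forall i, exists c, (c < size s)%N /\
      nu (q`_i - s`_c * p`_i) <= 2^-1 * nu p`_i.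
    move=> i; have [|l ls lP] := sP (q`_i / p`_i).
      rewrite modulusM modulusV; have [->|pi0] := eqVneq p`_i 0.
        by rewrite (modulus0 M) invr0 mulr0.
      rewrite ler_pdivrMr ?mul1r// lt_def modulus_ge0 andbT modulus_eq0//.
    exists (index l s); rewrite index_mem nth_index//; split=> //.
    have [pi0|pi0] := eqVneq p`_i 0.
      have := qp i; rewrite pi0 mulr0 subr0 (modulus0 M) mulr0 => /le_trans; exact.
    have -> : q`_i - l * p`_i = (q`_i / p`_i - l) * p`_i by field.
    by rewrite modulusM; apply: ler_wpM2r => //; apply: modulus_ge0.
  pose r := q - \sum_(c < size s) s`_c *: mask (fun i => col i == c) p.
  have rE i : r`_i = q`_i - s`_(col i) * p`_i.
    rewrite coefB coef_sum (bigD1 (Ordinal (colP i).1)) //= coefZ coef_mask eqxx.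
    rewrite big1 ?addr0// => c /eqP ci; rewrite coefZ coef_mask.
    by case: eqP => [e|_]; [case: ci; apply/val_inj|rewrite mulr0].
  have r2 : n (2%:R *: r) <= b.
    apply: Hb => i; rewrite coefZ modulusM modulus_nat rE.
    by have := (colP i).2; lra.
  move: r2; rewrite (seminormZ nP) modulus_nat => r2.
  have := seminorm_distl nP q (q - r); rewrite subKr.
  suff : n (q - r) <= L * n p by move: r2; lra.
  rewrite subKr mulr_suml; apply: le_trans (seminorm_sum nP _ _ _) _.
  apply: ler_sum => c _; rewrite (seminormZ nP) -mulrA.
  by apply: ler_wpM2l (maskB _ _); apply: modulus_ge0.
pose b0 := \sum_(i < size p) nu p`_i * n 'X^i.
have Hb0 : H b0.
  move=> q qp.
  have -> : q = \sum_(i < size p) q`_i *: 'X^i.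
    rewrite -poly_def; apply/polyP => i; rewrite coef_poly; case: ltnP => // pi.
    apply/eqP; rewrite -(modulus_eq0 M) eq_le modulus_ge0 andbT.
    by apply: le_trans (qp i) _; rewrite nth_default// (modulus0 M).
  apply: le_trans (seminorm_sum nP _ _ _) _; apply: ler_sum => i _.
  by rewrite (seminormZ nP); apply: ler_wpM2r (qp i); apply: seminorm_ge0 nP _.
apply: (@le_half_expn _ _ _ b0) => r; move: q0 q0p; rewrite -/(H _).
elim: r => [|r IH] q qp.
  rewrite expr0 mulr1; apply: le_trans (Hb0 q qp) _.
  by rewrite lerDr !mulr_ge0.
apply: le_trans (Hhalf _ IH q qp) _; rewrite exprS; lra.
Qed.

Definition bounded_below_on (phi : E * E -> R) G : Prop :=
  exists2 d, 0 < d & forall g, G g -> d * n g.1 <= phi g.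

Definition small_on (phi : E * E -> R) (eta : R) G : Prop :=
  forall g, G g -> phi g <= eta * n g.1.

(** Unless [phi] is bounded below on some subspace of finite codimension, it is
    arbitrarily small at vectors of [G] lying arbitrarily far out, hence small on
    the span of a suitable block sequence. *)
Lemma seminorm_dichotomy (phi : E * E -> R) (eta : R) G :
    seminorm M phi -> 0 < eta -> linear_set G -> rich G ->
  exists G', [/\ G' `<=` G, linear_set G', rich G' &
    bounded_below_on phi G' \/ small_on phi eta G'].
Proof.
move=> phiP e0 GP Grich.
have [[k [d d0 dP]]|nbelow] := pselect (exists k, exists2 d, 0 < d & forall g, G g ->
    take_poly k g.1 = 0 -> take_poly k g.2 = 0 -> d * n g.1 <= phi g).
  exists [set g | [/\ G g, take_poly k g.1 = 0 & take_poly k g.2 = 0]]; split.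
  - by move=> g [].
  - split; first by split; [exact: linear_set0|exact: raddf0|exact: raddf0].
    move=> c x y [Gx x1 x2] [Gy y1 y2]; split; first exact: GP.2.
    + by rewrite /= linearP /= x1 y1 scaler0 addr0.
    + by rewrite /= linearP /= x2 y2 scaler0 addr0.
  - move=> l; have [g [Gg g0 g1 g2]] := Grich (maxn k l).
    have tk a p : (a <= maxn k l)%N -> take_poly (maxn k l) p = 0 -> take_poly a p = 0.
      move=> am /take_poly_eq0 h; apply/take_poly_eq0 => i ia; apply: h.
      exact: leq_trans ia am.
    by exists g; split=> //=; [split=> //|..]; apply: tk; rewrite ?leq_maxl ?leq_maxr.
  - by left; exists d => // g [Gg g1 g2]; exact: dP.
pose Q (a b : nat) (eps : R) g := G g /\ phi g <= eps * n g.1.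
pose d (j : nat) : R := eta / (2 * C) * (2^-1) ^+ j.+1.
have [||k [u [uP uQ]]] := @block_seq_exists _ _ Q d.
- by move=> j; apply: weight_gt0.
- move=> a eps eps0.
  have [g [Gg g1 g2 gphi]] : exists g, [/\ G g, take_poly a g.1 = 0,
      take_poly a g.2 = 0 & phi g < eps * n g.1].
    apply: contrapT => h; apply: nbelow; exists a, eps => // g Gg g1 g2.
    by rewrite leNgt; apply/negP => lt; apply: h; exists g.
  exists (maxn a.+1 (maxn (size g.1) (size g.2))), g.
  split; last by split=> //; exact: ltW.
  + by rewrite leq_max ltnSn.
  + move=> i; rewrite !geq_max => /orP[ia|/and3P[_ + _]]; last exact: nth_default.
    by move/take_poly_eq0 : g1; apply.
  + move=> i; rewrite !geq_max => /orP[ia|/and3P[_ _ +]]; last exact: nth_default.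
    by move/take_poly_eq0 : g2; apply.
  + apply: contraTneq gphi => ->; rewrite (seminorm0 nP) mulr0 -leNgt.
    exact: seminorm_ge0 phiP _.
exists (lin_span u); split.
- by apply: lin_span_sub => // j; case: (uQ j).
- exact: lin_span_linear.
- exact: lin_span_rich uP.
- right; apply: (block_seminorm_le nP C0 n_take uP phiP (ltW e0)) => j.
  by case: (uQ j).
Qed.

(** Both alternatives of the dichotomy are inherited by subspaces, so that finitely
    many seminorms can be treated one after the other. *)
Lemma seminorm_dichotomies (phi : nat -> E * E -> R) (eta : R) m G :
    (forall c, seminorm M (phi c)) -> 0 < eta -> linear_set G -> rich G ->
  exists G', [/\ G' `<=` G, linear_set G', rich G' & forall c, (c < m)%N ->
    bounded_below_on (phi c) G' \/ small_on (phi c) eta G'].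
Proof.
move=> phiP e0 GP Grich; elim: m => [|m [G1 [G1G G1P G1r G1m]]].
  by exists G; split.
have [G2 [G21 G2P G2r G2m]] := seminorm_dichotomy (phiP m) e0 G1P G1r.
exists G2; split=> //; first exact: subset_trans G21 G1G.
move=> c; rewrite ltnS leq_eqVlt => /predU1P[-> //|/G1m[[d d0 dP]|sm]].
  by left; exists d => // g /G21; apply: dP.
by right => g /G21; apply: sm.
Qed.

(** The pairs of restrictions would form the graph of an isomorphism between
    subspaces with disjoint supports. *)
Lemma masks_not_both_below (A1 A2 : pred nat) (D : R) G :
    (forall i, A1 i -> A2 i -> False) -> linear_set G -> rich G -> 0 < D ->
    comparable_on n D G ->
    bounded_below_on (fun g => n (mask A1 g.1)) G ->
    bounded_below_on (fun g => n (mask A2 g.2)) G -> False.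
Proof.
move=> A12 GP Grich D0 GD [d1 d10 d1P] [d2 d20 d2P].
have [B B0 maskB] := mask_bounded.
pose f (g : E * E) := (mask A1 g.1, mask A2 g.2).
apply: (@tight (B / d2 + B * D / d1) [set f g | g in G]).
- split; first by exists 0; [exact: linear_set0|];
    congr pair; apply/polyP => i; rewrite coef_mask coef0 if_same.
  move=> c _ _ [x Gx <-] [y Gy <-]; exists (c *: x + y); first exact: GP.2.
  by congr pair; exact: mask_linear.
- move=> k; have [g [Gg g0 g1 g2]] := Grich k.
  exists (f g); split=> /=; [by exists g| |exact: mask_take_eq0|exact: mask_take_eq0].
  apply/eqP => e; have := d1P g Gg; rewrite e (seminorm0 nP) leNgt.
  by rewrite mulr_gt0// seminorm_gt0.
- move=> _ [g Gg <-] /=; have [_ gD] := GD g Gg.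
  have h1 := d1P g Gg; have h2 := d2P g Gg.
  have m1 := maskB A1 g.1; have m2 := maskB A2 g.2.
  have p1 := seminorm_ge0 nP (mask A1 g.1); have p2 := seminorm_ge0 nP (mask A2 g.2).
  have q1 : 0 <= B / d2 by rewrite divr_ge0// ltW.
  have q2 : 0 <= B * D / d1 by rewrite divr_ge0 ?mulr_ge0// ltW.
  rewrite !mulrDl; split.
    apply: (@le_trans _ _ (B / d2 * n (mask A2 g.2))); last by rewrite lerDl mulr_ge0.
    by apply: le_trans m1 _; rewrite -mulrA ler_pM2l// mulrC ler_pdivlMr// mulrC.
  apply: (@le_trans _ _ (B * D / d1 * n (mask A1 g.1))); last by rewrite lerDr mulr_ge0.
  apply: le_trans m2 _; rewrite -!mulrA ler_pM2l//; apply: le_trans gD _.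
  by rewrite ler_pM2l// mulrC ler_pdivlMr// mulrC.
- move=> _ _ i [g _ <-] [h _ <-]; rewrite /f /= !coef_mask.
  case: ifP => [a1|]; last by left.
  by case: ifP => [a2|]; [case: (A12 i)|right].
Qed.

(** Along a block sequence of pairs, coordinates are colored according to the
    approximate ratio of the second component to the first; since both components
    of a vector of the span are multiples of those of a block, the coloring serves
    all of the span at once. Tightness leaves only one color alive on a subspace,
    where the second component is then nearly a multiple of the first. *)
Theorem block_seq_almost_proportional k u (D : R) :
    block_seq k u -> 0 < D -> comparable_on n D (lin_span u) ->
  forall eps : R, 0 < eps -> exists x lam,
    [/\ lin_span u x, x.1 != 0 & n (x.2 - lam *: x.1) <= eps * n x.1].
Proof.
move=> uP D0 uD eps e0.
have [B B0 multB] := multiplier_bounded.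
have mult (r : R) p q : 0 <= r -> (forall i, nu q`_i <= r * nu p`_i) -> n q <= B * r * n p.
  move=> r0 qp; rewrite -mulrA -{1}(modulus_of_real M r0) -(seminormZ nP).
  by apply: multB => i; rewrite coefZ modulusM modulus_of_real.
(* With this threshold, the part of [g.1] of the color of the large ratios has norm at
   most [n g.1 / 4]. *)
pose big : R := 4 * (B * D).
have big0 : 0 < big by rewrite !mulr_gt0.
have [|s sP] := modulus_net_disc M big0 (eps := eps / (2 * B)).
  by rewrite divr_gt0// mulr_gt0.
set m := size s.
(* The colors below [m] stand for the ratios of the net, the color [m] for large ones. *)
have /choice[col colP] : forall i, exists c, (c < m.+1)%N /\ forall x, lin_span u x ->
    if c == m then big * nu x.1`_i <= nu x.2`_i
    else nu (x.2`_i - s`_c * x.1`_i) <= eps / (2 * B) * nu x.1`_i.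
  move=> i.
  have [ik|[j ij]] := block_seq_cover uP i.
    exists m; split=> // x /(lin_span_coef uP)[/(_ i ik)[-> ->] _].
    by rewrite eqxx (modulus0 M) mulr0.
  have ratio x : lin_span u x -> exists c, x.1`_i = c * (u j).1`_i /\ x.2`_i = c * (u j).2`_i.
    by move=> /(lin_span_coef uP)[_ /(_ j)[c cP]]; exists c; apply: cP.
  set a := (u j).1`_i in ratio; set b := (u j).2`_i in ratio.
  have [ab|ab] := leP (big * nu a) (nu b).
    exists m; split=> // x /ratio[c [-> ->]]; rewrite eqxx !modulusM mulrCA.
    by apply: ler_wpM2l => //; apply: modulus_ge0.
  have a0 : a != 0.
    by apply: contraTneq ab => ->; rewrite (modulus0 M) mulr0 -leNgt modulus_ge0.
  have nua : 0 < nu a by rewrite lt_def modulus_ge0 modulus_eq0 a0.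
  have [|l ls lP] := sP (b / a).
    by rewrite modulusM modulusV ler_pdivrMr// ltW.
  have lm : (index l s < m)%N by rewrite index_mem.
  exists (index l s); split=> [|x /ratio[c [-> ->]]]; first exact: ltnW.
  rewrite ltn_eqF// nth_index//.
  have -> : c * b - l * (c * a) = (b / a - l) * (c * a) by field.
  by rewrite modulusM; apply: ler_wpM2r => //; apply: modulus_ge0.
have colm i : (col i < m.+1)%N := (colP i).1.
pose P (c : nat) (p : E) : E := mask (fun i => col i == c) p.
pose lams := \sum_(c < m) nu s`_c.
have lams0 : 0 <= lams by apply: sumr_ge0 => c _; apply: modulus_ge0.
have lamP c : (c < m)%N -> nu s`_c <= lams.
  move=> cm; rewrite /lams (bigD1 (Ordinal cm)) //= lerDl.
  by apply: sumr_ge0 => i _; apply: modulus_ge0.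
(* The three terms of the denominator account for [g.1], for [g.2], whose norm is at
   most [D] times that of [g.1], and for [lam *: g.1]. *)
pose tau : R := Num.min (4^-1) (eps / 2) / (1 + D + lams).
have den0 : 0 < 1 + D + lams by rewrite ltr_wpDr// addr_gt0.
have tau0 : 0 < tau by rewrite divr_gt0// lt_min invr_gt0 ltr0n divr_gt0.
have tauP : tau * (1 + D + lams) <= 4^-1 /\ tau * (1 + D + lams) <= eps / 2.
  by rewrite divfK ?gt_eqF// !ge_min !lexx orbT.
have [tD tl] : 0 <= tau * D /\ 0 <= tau * lams by split; apply: mulr_ge0 => //; apply: ltW.
(* There are [m.+1] colors, so that the small ones contribute at most [tau]
   times the norm of [g.1] in all. *)
pose eta : R := tau / m.+1%:R.
have eta0 : 0 < eta by rewrite divr_gt0.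
have maskS c p q : P c (p + q) = P c p + P c q by apply: maskD.
have snP (T : E * E -> E) c : (forall g h, T (g + h) = T g + T h) ->
    (forall a g, T (a *: g) = a *: T g) -> seminorm M (fun g => n (P c (T g))).
  move=> TD TZ; split=> [x y|a x]; first by rewrite TD maskS (seminormD nP).
  by rewrite TZ [P _ _]maskZ (seminormZ nP).
have [G1 [G1u G1P G1r G1m]] := seminorm_dichotomies m.+1
  (fun c => snP (fun g => g.1) c (fun _ _ => erefl) (fun _ _ => erefl))
  eta0 (lin_span_linear u) (lin_span_rich uP).
have [G2 [G21 G2P G2r G2m]] := seminorm_dichotomies m.+1
  (fun c => snP (fun g => g.2) c (fun _ _ => erefl) (fun _ _ => erefl))
  eta0 G1P G1r.
have G2u : G2 `<=` lin_span u by apply: subset_trans G21 G1u.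
have G2D : comparable_on n D G2 by move=> g /G2u; apply: uD.
have dich1 c : (c < m.+1)%N -> bounded_below_on (fun g => n (P c g.1)) G2 \/
    small_on (fun g => n (P c g.1)) eta G2.
  move=> /G1m[[d d0 dP]|sm]; [left; exists d => // g /G21; apply: dP|].
  by right => g /G21; apply: sm.
have [g [G2g g0 _ _]] := G2r 0%N.
have N0 := seminorm_gt0 g0; set N := n g.1 in N0.
have [gD1 gD2] := G2D g G2g; rewrite -/N in gD1 gD2.
have rest (p : E) (bad : pred nat) :
    (forall c, (c < m.+1)%N -> ~~ bad c -> n (P c p) <= eta * N) ->
    n (\sum_(c < m.+1 | ~~ bad c) P c p) <= tau * N.
  move=> h; apply: le_trans (seminorm_sum nP _ _ _) _.
  apply: (@le_trans _ _ (\sum_(c < m.+1 | ~~ bad c) eta * N)).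
    by apply: ler_sum => c; apply: h.
  have eN0 : 0 <= eta * N by rewrite mulr_ge0// ltW.
  apply: (@le_trans _ _ (\sum_(c < m.+1) eta * N)).
    by rewrite big_mkcond; apply: ler_sum => c _; case: ifP.
  by rewrite sumr_const card_ord -mulr_natr /eta mulrAC divfK// ?pnatr_eq0// mulrC.
have sumP p : \sum_(c < m.+1) P c p = p by apply: sum_mask.
have [c cm cbelow] : exists2 c, (c < m.+1)%N & bounded_below_on (fun g => n (P c g.1)) G2.
  apply: contrapT => h.
  have : n (\sum_(c < m.+1 | ~~ false) P c g.1) <= tau * N.
    apply: (rest _ xpred0) => c cm _; have [b|] := dich1 c cm; last exact.
    by case: h; exists c.
  by rewrite sumP -/N; have := tauP.1; nra.
have [c' c'm c'below] : exists2 c, (c < m.+1)%N & bounded_below_on (fun g => n (P c g.2)) G2.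
  apply: contrapT => h.
  have : n (\sum_(c < m.+1 | ~~ false) P c g.2) <= tau * N.
    apply: (rest _ xpred0) => a am _; have [b|] := G2m a am; last exact.
    by case: h; exists a.
  by rewrite sumP; have := tauP.1; nra.
have disj a b : bounded_below_on (fun g => n (P a g.1)) G2 ->
    bounded_below_on (fun g => n (P b g.2)) G2 -> a = b.
  move=> ha hb; have [//|/eqP ab] := eqVneq a b; exfalso.
  by apply: (masks_not_both_below _ G2P G2r D0 G2D ha hb) => i /eqP ea /eqP eb; apply: ab; rewrite -ea -eb.
have c'E := disj _ _ cbelow c'below; rewrite -{c'}c'E in c'm c'below.
have split1 p : p - P c p = \sum_(a < m.+1 | ~~ (a == c :> nat)) P a p.
  rewrite -{1}(sumP p) (bigD1 (Ordinal cm)) //= addrAC subrr add0r.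
  by apply: eq_bigl => a.
have rest1 : n (g.1 - P c g.1) <= tau * N.
  rewrite split1; apply: (rest _ (pred1 c)) => a am ac.
  have [b|] := dich1 a am; last exact.
  by rewrite (disj _ _ b c'below) /= eqxx in ac.
have rest2 : n (g.2 - P c g.2) <= tau * N.
  rewrite split1; apply: (rest _ (pred1 c)) => a am ac.
  have [b|] := G2m a am; last exact.
  by rewrite -(disj _ _ cbelow b) /= eqxx in ac.
have cNm : c != m.
  apply/eqP => ce.
  have : n (P c g.1) <= B * big^-1 * n g.2.
    apply: mult; first by rewrite invr_ge0 ltW.
    move=> i; rewrite coef_mask; case: eqP => [ci|_].
      have := (colP i).2 g (G2u _ G2g).
      by rewrite ci ce eqxx => h; rewrite mulrC ler_pdivlMr// mulrC.
    by rewrite (modulus0 M) mulr_ge0 ?modulus_ge0// invr_ge0 ltW.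
  have -> : B * big^-1 = (4 * D)^-1 by rewrite /big; field; rewrite !gt_eqF.
  rewrite mulrC ler_pdivlMr ?mulr_gt0// => h.
  have := seminorm_distl nP g.1 (P c g.1); rewrite -/N => h'.
  have h2 : 4 * n (P c g.1) <= N.
    by rewrite -(ler_pM2l D0); move: h gD2; nra.
  by have := tauP.1; nra.
have cm' : (c < m)%N by rewrite ltn_neqAle cNm -ltnS.
exists g, s`_c; split=> //; first exact: G2u.
have E1 : n (P c (g.2 - s`_c *: g.1)) <= eps / 2 * N.
  have -> : eps / 2 = B * (eps / (2 * B)) by field; rewrite gt_eqF.
  apply: mult; first by rewrite divr_ge0 ?mulr_ge0// ltW.
  move=> i; rewrite coef_mask; case: eqP => [ci|_].
    have := (colP i).2 g (G2u _ G2g).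
    by rewrite ci (negbTE cNm) coefB coefZ.
  by rewrite (modulus0 M) mulr_ge0 ?modulus_ge0// divr_ge0 ?mulr_ge0// ltW.
have -> : g.2 - s`_c *: g.1 = P c (g.2 - s`_c *: g.1) + ((g.2 - P c g.2) -
    s`_c *: (g.1 - P c g.1)).
  have -> : P c (g.2 - s`_c *: g.1) = P c g.2 - s`_c *: P c g.1.
    by rewrite -scaleNr maskS [P c (_ *: _)]maskZ scaleNr.
  by rewrite scalerBr; ring.
have := seminormD nP (P c (g.2 - s`_c *: g.1)) ((g.2 - P c g.2) - s`_c *: (g.1 - P c g.1)).
have := seminormB nP (g.2 - P c g.2) (s`_c *: (g.1 - P c g.1)).
rewrite (seminormZ nP).
have : nu s`_c * n (g.1 - P c g.1) <= lams * (tau * N).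
  by apply: ler_pM => //; [exact: modulus_ge0|exact: seminorm_ge0 nP _|exact: lamP].
have := ler_wpM2r (ltW N0) tauP.2.
have : 0 <= tau * D * N by rewrite mulr_ge0// ltW.
rewrite -/N; lra.
Qed.

End TightPoly.

(** * Real-valued norms on normed modules *)

Section RealNorm.
Context {R : realType} {K : numFieldType} (M : real_modulus R K).
Local Notation nu := (modulus M).
Local Notation iota := (of_real M).

Definition rnorm (X : normedModType K) (x : X) : R := nu `|x|.

Section NormedModule.
Context {X : normedModType K}.
Implicit Types (x y : X) (A : set X).
Local Notation N := (@rnorm X).

Lemma rnormE x : `|x| = iota (N x).
Proof. by rewrite /rnorm -(of_realE M) normr_id. Qed.

Lemma rnorm_seminorm : seminorm M N.
Proof.
split=> [x y|c x]; last by rewrite /rnorm normrZ modulusM (of_realE M c) modulus_of_real ?modulus_ge0.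
by rewrite -(of_real_le M) rmorphD -!rnormE ler_normD.
Qed.

Lemma rnorm_eq0 x : N x = 0 -> x = 0.
Proof. by move/(congr1 iota); rewrite -rnormE rmorph0 => /eqP; rewrite normr_eq0 => /eqP. Qed.

Lemma rnorm_gt0 x : x != 0 -> 0 < N x.
Proof.
move=> x0; rewrite lt_def (seminorm_ge0 rnorm_seminorm) andbT.
by apply: contra x0 => /eqP/rnorm_eq0/eqP.
Qed.

Lemma gt0_of_real (e : K) : 0 < e -> exists2 r, 0 < r & e = iota r.
Proof.
move=> e0; have E : e = iota (nu e) by rewrite -(of_realE M) gtr0_norm.
by exists (nu e) => //; rewrite -(of_real_lt M) rmorph0 -E.
Qed.

Lemma of_real_gt0 (e : R) : (0 < iota e) = (0 < e).
Proof. by rewrite -(of_real_lt M) rmorph0. Qed.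

Lemma norm_lt_of_real x (e : R) : (`|x| < iota e) = (N x < e).
Proof. by rewrite rnormE of_real_lt. Qed.

Lemma cvg_rnormP (u : nat -> X) x : u @ \oo --> x <->
  (forall e : R, 0 < e -> exists m, forall i, (m <= i)%N -> N (x - u i) < e).
Proof.
split=> [/cvgrPdist_lt h e e0|h].
  have [|m _ mP] := h (iota e); first by rewrite of_real_gt0.
  by exists m => i mi; rewrite -norm_lt_of_real; apply: mP.
apply/cvgrPdist_lt => _ /gt0_of_real[e e0 ->].
have [m mP] := h _ e0; exists m => // i mi /=.
by rewrite norm_lt_of_real mP.
Qed.

Lemma nbhs_rnormP x (P : set X) : nbhs x P <->
  exists2 e : R, 0 < e & forall y, N (x - y) < e -> P y.
Proof.
split=> [/nbhs_normP[_ /gt0_of_real[e e0 ->] h]|[e e0 h]].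
  by exists e => // y xy; apply: h; rewrite /= norm_lt_of_real.
apply/nbhs_normP; exists (iota e) => /=; first by rewrite of_real_gt0.
by move=> y; rewrite /= norm_lt_of_real; apply: h.
Qed.

Lemma closed_rnormP A : closed A <->
  (forall x, (forall e : R, 0 < e -> exists2 y, A y & N (x - y) < e) -> A x).
Proof.
split=> [cA x xA|h].
  apply: cA => B /nbhs_rnormP[e e0 eB].
  by have [y Ay xy] := xA e e0; exists y; split=> //; apply: eB.
move=> x xA; apply: h => e e0.
have [|y [Ay xy]] := xA [set y | N (x - y) < e].
  by apply/nbhs_rnormP; exists e.
by exists y.
Qed.

End NormedModule.

Section Continuity.
Context {X : normedModType K} {Y : set X} {T : X -> X} (YP : linear_set Y) (TP : linear_on Y T).
Local Notation N := (@rnorm X).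

Lemma linear_on0 : T 0 = 0.
Proof.
have := TP 1 (linear_set0 YP) (linear_set0 YP); rewrite !scale1r addr0.
by move/eqP; rewrite -subr_eq0 opprD addNKr oppr_eq0 => /eqP.
Qed.

Lemma linear_onZ c y : Y y -> T (c *: y) = c *: T y.
Proof.
by move=> Yy; have := TP c Yy (linear_set0 YP); rewrite linear_on0 !addr0.
Qed.

Lemma linear_onB x y : Y x -> Y y -> T (x - y) = T x - T y.
Proof.
by move=> Yx Yy; rewrite addrC -scaleN1r TP// scaleN1r addrC.
Qed.

(** Scale [y] into the ball on which continuity at 0 bounds [T] by 1. *)
Lemma within_continuous_bounded : {within Y, continuous T} ->
  exists2 D : R, 0 < D & forall y, Y y -> N (T y) <= D * N y.
Proof.
move=> /subspace_continuousP/(_ 0 (linear_set0 YP)) cT.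
have /cT/nbhs_rnormP[e e0 eP] : nbhs (T 0) [set z | N z < 1].
  apply/nbhs_rnormP; exists 1 => // y.
  by rewrite linear_on0 sub0r (seminormN rnorm_seminorm).
exists (2 / e); first by rewrite divr_gt0.
move=> y Yy; have [->|y0] := eqVneq y 0.
  by rewrite linear_on0 (seminorm0 rnorm_seminorm) mulr0.
have Ny := rnorm_gt0 y0; pose r := e / (2 * N y).
have r0 : 0 < r by rewrite divr_gt0// mulr_gt0.
have rE (z : X) : N (iota r *: z) = r * N z.
  by rewrite (seminormZ rnorm_seminorm) modulus_of_real// ltW.
have : N (T (iota r *: y)) < 1.
  apply: eP; last exact: linear_setZ.
  rewrite sub0r (seminormN rnorm_seminorm) rE /r.
  have -> : e / (2 * N y) * N y = e / 2 by field; rewrite gt_eqF.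
  by rewrite gtr_pMr// invf_lt1// ltr1n.
rewrite linear_onZ// rE /r mulrAC ltr_pdivrMr ?mulr_gt0// mul1r => h'.
by rewrite mulrAC ler_pdivlMr// mulrC ltW.
Qed.

Lemma bounded_within_continuous (D : R) :
  (forall y, Y y -> N (T y) <= D * N y) -> {within Y, continuous T}.
Proof.
move=> TD; apply/subspace_continuousP => x Yx B /nbhs_rnormP[e e0 eB].
have D0 : 0 < `|D| + 1 by rewrite ltr_wpDl.
apply/nbhs_rnormP; exists (e / (`|D| + 1)); first exact: divr_gt0.
move=> y xy Yy; apply: eB; rewrite -linear_onB//.
apply: le_lt_trans (TD _ (linear_setB YP Yx Yy)) _.
rewrite ltr_pdivlMr// mulrC in xy; apply: le_lt_trans xy.
apply: ler_wpM2r; first exact: seminorm_ge0 rnorm_seminorm _.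
by rewrite (le_trans (ler_norm D))// lerDl.
Qed.

End Continuity.

Section Complete.
Context {X : completeNormedModType K}.
Local Notation N := (@rnorm X).

Lemma rnorm_complete (u : nat -> X) :
  (forall e : R, 0 < e -> exists m, forall i j, (m <= i)%N -> (m <= j)%N ->
    N (u i - u j) < e) ->
  exists l, forall e : R, 0 < e -> exists m, forall i, (m <= i)%N -> N (l - u i) < e.
Proof.
move=> h; suff /cvg_ex[l /cvg_rnormP lP] : cvg (u @ \oo) by exists l.
apply: cauchy_cvg; apply/cauchy_exP => _ /gt0_of_real[e e0 ->].
have [m mP] := h _ e0; exists (u m); exists m => // i mi.
by rewrite -ball_normE /= norm_lt_of_real mP/=.
Qed.

(** The Baire category theorem. Each [F m] with no interior point in its closure
    is avoided by passing to a smaller ball; the centers of these balls converge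
    to a point outside all [F m]. *)
Lemma category_cover (F : nat -> set X) : (forall x, exists m, F m x) ->
  exists m x0 (r : R), 0 < r /\ forall x, N (x - x0) < r ->
    forall e : R, 0 < e -> exists2 y, F m y & N (x - y) < e.
Proof.
move=> cov; apply: contrapT => h.
have step (mxr : nat * (X * R)) : exists xr : X * R, 0 < mxr.2.2 ->
    [/\ 0 < xr.2, xr.2 <= mxr.2.2 / 2, N (xr.1 - mxr.2.1) + xr.2 < mxr.2.2 &
      forall y, F mxr.1 y -> xr.2 < N (xr.1 - y)].
  case: mxr => m [x0 r] /=; have [r0|r0] := ltP 0 r; last first.
    by exists (x0, r) => /=; rewrite ltNge r0.
  have [x [xr [e e0 xe]]] : exists x, N (x - x0) < r /\
      exists2 e : R, 0 < e & forall y, F m y -> e <= N (x - y).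
    apply: contrapT => hx; apply: h; exists m, x0, r; split=> // x xr e e0.
    apply: contrapT => hy; apply: hx; exists x; split=> //; exists e => // y Fy.
    by rewrite leNgt; apply/negP => xy; apply: hy; exists y.
  exists (x, Num.min (r / 2) (Num.min ((r - N (x - x0)) / 2) (e / 2))) => /= _; split.
  - by rewrite !lt_min !divr_gt0// subr_gt0.
  - by rewrite ge_min lexx.
  - set t := Num.min _ _; have : t <= (r - N (x - x0)) / 2.
      by rewrite /t !ge_min lexx orbT.
    by lra.
  - move=> y /xe; set t := Num.min _ _; have : t <= e / 2.
      by rewrite /t !ge_min lexx !orbT.
    by lra.
have [f fP] := choice step.
pose b := fix b m := if m is l.+1 then f (l, b l) else (0 : X, 1 : R).
have b0 m : 0 < (b m).2.
  by elim: m => [|m IH] //=; case: (fP (m, b m) IH).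
have bP m := fP (m, b m) (b0 m).
have bhalf m : (b m).2 <= (2^-1) ^+ m.
  elim: m => [|m IH]; first by rewrite expr0.
  by have [_ + _ _] := bP m; rewrite exprS /=; move: IH; lra.
have nested i j : (i <= j)%N -> N ((b j).1 - (b i).1) + (b j).2 <= (b i).2.
  move=> ij; rewrite -(subnKC ij); elim: (j - i)%N => [|d IH].
    by rewrite addn0 subrr (seminorm0 rnorm_seminorm) add0r.
  rewrite addnS; have [_ _ + _] := bP (i + d)%N.
  have := seminormD rnorm_seminorm ((b (i + d).+1).1 - (b (i + d)%N).1)
    ((b (i + d)%N).1 - (b i).1).
  by rewrite addrA subrK; move: IH => /=; lra.
have [|l lP] := @rnorm_complete (fun m => (b m).1).
  move=> e e0; have [m me] := half_expn_lt (2 : R) e0; exists m => i j mi mj.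
  have := nested _ _ mi; have := nested _ _ mj; have := b0 i; have := b0 j.
  have := bhalf m; have := seminormB rnorm_seminorm ((b i).1 - (b m).1) ((b j).1 - (b m).1).
  by rewrite opprB addrA subrK; lra.
have lb i : N (l - (b i).1) <= (b i).2.
  apply/ler_addgt0Pr => e e0; have [m mP] := lP e e0.
  have := mP (maxn m i) (leq_maxl _ _); have := nested _ _ (leq_maxr m i).
  have := b0 (maxn m i).
  have := seminormD rnorm_seminorm (l - (b (maxn m i)).1) ((b (maxn m i)).1 - (b i).1).
  by rewrite addrA subrK; lra.
have [m Fl] := cov l; have [_ _ _ /(_ l Fl)] := bP m.
by have := lb m.+1; rewrite (seminormBC rnorm_seminorm) /=; lra.
Qed.

End Complete.

End RealNorm.

(** * Schauder bases *)

Definition psum (K : pzRingType) (V : lmodType K) (u : nat -> V) (a : nat -> K)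
  (k : nat) : V := \sum_(i < k) a i *: u i.

Section Basis.
Context {R : realType} {K : numFieldType} (M : real_modulus R K)
  {X : completeNormedModType K} {e : nat -> X} (eP : schauder_basis e).
Local Notation nu := (modulus M).
Local Notation iota := (of_real M).
Local Notation N := (@rnorm R K M X).
Local Notation NP := (@rnorm_seminorm R K M X).
Local Notation co := (coordinates e).
Implicit Types (x y : X) (a : nat -> K) (p q : {poly K}).

Definition partial_sum (u : nat -> X) (k : nat) x : X := psum u (coordinates u x) k.

Definition realize (u : nat -> X) p : X := psum u (nth 0 p) (size p).

Local Notation S := (partial_sum e).
Local Notation J := (realize e).

Lemma expansionP x a : expansion e x a <->
  (forall d : R, 0 < d -> exists m, forall i, (m <= i)%N -> N (x - psum e a i) < d).
Proof.
rewrite /expansion (_ : series _ = psum e a); first exact: cvg_rnormP.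
by apply/funext => k; rewrite /psum seriesEord.
Qed.

Lemma coordinates_expansion x : expansion e x (co x).
Proof. by apply: xgetPex; have [a [aP _]] := eP x; exists a. Qed.

Lemma coordinates_eq x a : expansion e x a -> co x = a.
Proof.
have [b [_ bP]] := eP x => xa.
by rewrite -(bP _ xa); apply/esym/bP/coordinates_expansion.
Qed.

Lemma psum_linear a b c k :
  psum e (fun i => c * a i + b i) k = c *: psum e a k + psum e b k.
Proof.
rewrite /psum scaler_sumr -big_split /=; apply: eq_bigr => i _.
by rewrite scalerDl scalerA.
Qed.

Lemma coordinates_linear c x y i : co (c *: x + y) i = c * co x i + co y i.
Proof.
rewrite (@coordinates_eq _ (fun i => c * co x i + co y i))//.
apply/expansionP => d d0.
pose d' := d / (nu c + 2).
have c2 : 0 < nu c + 2 by rewrite ltr_wpDl ?modulus_ge0.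
have d'0 : 0 < d' by rewrite divr_gt0.
have [m1 m1P] := (@expansionP x (co x)).1 (@coordinates_expansion x) _ d'0.
have [m2 m2P] := (@expansionP y (co y)).1 (@coordinates_expansion y) _ d'0.
exists (maxn m1 m2) => k; rewrite geq_max => /andP[/m1P h1 /m2P h2].
rewrite psum_linear opprD addrACA -scalerBr.
apply: le_lt_trans (seminormD NP _ _) _; rewrite (seminormZ NP).
have dE : d = d' * (nu c + 2) by rewrite /d' divfK ?gt_eqF.
have h3 : nu c * N (x - psum e (co x) k) <= nu c * d'.
  by apply: ler_wpM2l; [exact: modulus_ge0|exact: ltW].
by move: h2 h3; rewrite dE; lra.
Qed.

Lemma partial_sum_linear c x y k : S k (c *: x + y) = c *: S k x + S k y.
Proof.
rewrite /partial_sum -psum_linear; congr (psum _ _ _).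
by apply/funext => i; apply: coordinates_linear.
Qed.

Lemma coordinates0 i : co 0 i = 0.
Proof.
by have := coordinates_linear 1 0 0 i; rewrite scale1r mul1r addr0 => /eqP;
  rewrite -subr_eq0 opprD addNKr oppr_eq0 => /eqP.
Qed.

Lemma coordinatesB x y i : co (x - y) i = co x i - co y i.
Proof. by rewrite addrC -scaleN1r coordinates_linear mulN1r addrC. Qed.

Lemma coordinatesZ c x i : co (c *: x) i = c * co x i.
Proof. by rewrite -[c *: x]addr0 coordinates_linear coordinates0 addr0. Qed.

Lemma partial_sum0 k : S k 0 = 0.
Proof.
by rewrite /partial_sum /psum big1 // => i _; rewrite coordinates0 scale0r.
Qed.

Lemma partial_sumD k x y : S k (x + y) = S k x + S k y.
Proof. by rewrite -[x]scale1r partial_sum_linear !scale1r. Qed.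

Lemma partial_sumB k x y : S k (x - y) = S k x - S k y.
Proof. by rewrite addrC -scaleN1r partial_sum_linear scaleN1r addrC. Qed.

Lemma partial_sum_cvg x (d : R) : 0 < d ->
  exists m, forall k, (m <= k)%N -> N (x - S k x) < d.
Proof. by move: d; apply/expansionP/coordinates_expansion. Qed.

Lemma coordinates_eq0 x : (forall i, co x i = 0) -> x = 0.
Proof.
move=> h; apply: (rnorm_eq0 (M := M)); apply/eqP; rewrite eq_le (seminorm_ge0 NP) andbT.
apply/ler_addgt0Pr => d d0; rewrite add0r.
have [m /(_ m (leqnn m))] := partial_sum_cvg x d0.
rewrite /partial_sum /psum big1 ?subr0 => [/ltW //|i _].
by rewrite h scale0r.
Qed.

Lemma psum_widen a k m : (forall i, (k <= i)%N -> a i = 0) -> (k <= m)%N ->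
  psum e a m = psum e a k.
Proof.
move=> a0 km; rewrite /psum (big_ord_widen _ (fun i => a i *: e i) km) [RHS]big_mkcond.
by apply: eq_bigr => i _; case: ltnP => // /a0 ->; rewrite scale0r.
Qed.

Lemma coordinates_psum a k : (forall i, (k <= i)%N -> a i = 0) ->
  co (psum e a k) = a.
Proof.
move=> a0; apply: coordinates_eq; apply/expansionP => d d0; exists k => i ki.
by rewrite (psum_widen a0 ki) subrr (seminorm0 NP).
Qed.

Lemma coordinates_realize p : co (J p) = nth 0 p.
Proof. by apply: coordinates_psum => i; exact: nth_default. Qed.

Lemma realizeE p m : (size p <= m)%N -> J p = psum e (nth 0 p) m.
Proof. by move=> pm; rewrite (psum_widen _ pm)// => i; exact: nth_default. Qed.

Lemma realize_linear c p q : J (c *: p + q) = c *: J p + J q.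
Proof.
set r := c *: p + q; pose m := maxn (size r) (maxn (size p) (size q)).
have [rm pm qm] : [/\ size r <= m, size p <= m & size q <= m]%N by rewrite /m !leq_max !leqnn !orbT.
rewrite (realizeE rm) (realizeE pm) (realizeE qm).
rewrite -psum_linear; congr (psum _ _ _).
by apply/funext => i; rewrite coefD coefZ.
Qed.

Lemma realize_poly k a : J (\poly_(i < k) a i) = psum e a k.
Proof.
rewrite (@realizeE _ k (size_poly _ _)) /psum; apply: eq_bigr => i _.
by rewrite coef_poly ltn_ord.
Qed.

Lemma realize_take k p : J (take_poly k p) = S k (J p).
Proof.
by rewrite /partial_sum coordinates_realize -realize_poly; congr (J _).
Qed.

Lemma realize_seminorm : seminorm M (fun p => N (J p)).
Proof.
split=> [p q|c p]; first by rewrite -[p]scale1r realize_linear !scale1r (seminormD NP).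
rewrite -[c *: p]addr0 realize_linear (_ : J 0 = 0) ?addr0 ?(seminormZ NP)//.
by rewrite /realize /psum size_poly0 big_ord0.
Qed.

Lemma realize_eq0 p : J p = 0 -> p = 0.
Proof.
by move=> Jp; apply/polyP => i; rewrite -coordinates_realize Jp coordinates0 coef0.
Qed.

Lemma coordinate_term i x : co x i *: e i = S i.+1 x - S i x.
Proof. by rewrite /partial_sum /psum big_ord_recr /= addrAC subrr add0r. Qed.

Lemma basis_neq0 i : e i != 0.
Proof.
apply/eqP => ei; have J0 : J 'X^i = 0.
  rewrite /realize /psum big1 // => l _; rewrite coefXn.
  by case: eqP => [->|_]; rewrite ?ei ?scaler0// scale0r.
by have /eqP := realize_eq0 J0; rewrite -size_poly_eq0 size_polyXn.
Qed.

(** Banach's theorem that partial sums are uniformly bounded. By the category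
    theorem, a fixed multiple of the unit ball of the norm [sup_k N (S k x)] is
    dense in a ball, so that each vector is the sum of a series converging fast in
    both norms; the coordinates of the terms add up to those of the vector. *)
Theorem partial_sum_bounded : exists2 C : R, 0 < C & forall k x, N (S k x) <= C * N x.
Proof.
have [m [x0 [r [r0 mP]]]] : exists m x0 (r : R), 0 < r /\ forall x, N (x - x0) < r ->
    forall d : R, 0 < d -> exists2 y, (forall k, N (S k y) <= m%:R) & N (x - y) < d.
  apply: (@category_cover _ _ M X (fun m => [set x | forall k, N (S k x) <= m%:R])) => x.
  have [m mP] := partial_sum_cvg x ltr01.
  pose b := N x + 1 + \sum_(k < m) N (S k x).
  have Nx := seminorm_ge0 NP x.
  have b0 : 0 <= \sum_(k < m) N (S k x) by apply: sumr_ge0 => k _; apply: seminorm_ge0 NP _.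
  exists (Num.truncn b).+1 => k; apply: le_trans (ltW (truncnS_gt b)).
  have [/mP xk|km] := leqP m k.
    have := seminorm_distl NP (S k x) x; rewrite (seminormBC NP).
    by move: xk b0; rewrite /b; lra.
  have : N (S k x) <= \sum_(k < m) N (S k x).
    rewrite (bigD1 (Ordinal km)) //= lerDl.
    by apply: sumr_ge0 => i _; apply: seminorm_ge0 NP _.
  by rewrite /b; lra.
(* The factor 4 comes from scaling to radius [r / 2] and from subtracting an
   approximation of the center [x0] of the ball. *)
pose L := 4 * m%:R / r.
have L0 : 0 <= L by rewrite divr_ge0 ?mulr_ge0// ltW.
have approx x (d : R) : 0 < d ->
    exists y, (forall k, N (S k y) <= L * N x) /\ N (x - y) < d.
  move=> d0; have [->|x_neq0] := eqVneq x 0.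
    exists 0; split=> [k|]; last by rewrite subrr (seminorm0 NP).
    by rewrite partial_sum0 (seminorm0 NP) mulr0.
  have Nx : 0 < N x := rnorm_gt0 M x_neq0.
  pose t := r / (2 * N x).
  have t0 : 0 < t by rewrite divr_gt0// mulr_gt0.
  have it0 : iota t != 0 by rewrite fmorph_eq0 gt_eqF.
  have td0 : 0 < t * d / 2 by rewrite divr_gt0// mulr_gt0.
  have [|y1 y1S y1P] := mP (x0 + iota t *: x) _ _ td0.
    rewrite addrC addKr (seminormZ NP) modulus_of_real ?(ltW t0)// /t.
    have -> : r / (2 * N x) * N x = r / 2 by field; rewrite gt_eqF.
    by lra.
  have [|y2 y2S y2P] := mP x0 _ _ td0; first by rewrite subrr (seminorm0 NP).
  exists ((iota t)^-1 *: (y1 - y2)); split=> [k|].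
    have -> : S k ((iota t)^-1 *: (y1 - y2)) = (iota t)^-1 *: (S k y1 - S k y2).
      by rewrite -partial_sumB -[_ *: _]addr0 partial_sum_linear partial_sum0 addr0.
    rewrite (seminormZ NP) modulusV modulus_of_real ?(ltW t0)//.
    rewrite mulrC ler_pdivrMr// (_ : L * N x * t = 2 * m%:R); last first.
      by rewrite /L /t; field; rewrite !gt_eqF.
    by have := seminormB NP (S k y1) (S k y2); have := y1S k; have := y2S k; lra.
  have -> : x - (iota t)^-1 *: (y1 - y2) =
      (iota t)^-1 *: ((x0 + iota t *: x - y1) - (x0 - y2)).
    rewrite opprB [x0 + _]addrC -!addrA [x0 + _]addrC -!addrA addNr addr0.
    by rewrite [RHS]scalerDr scalerA mulVf// scale1r [- y1 + y2]addrC -[y2 - y1]opprB scalerN.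
  rewrite (seminormZ NP) modulusV modulus_of_real ?(ltW t0)//.
  rewrite mulrC ltr_pdivrMr//.
  have := seminormB NP (x0 + iota t *: x - y1) (x0 - y2); rewrite [t * d]mulrC in y1P y2P *; lra.
exists (2 * L + 1); first by rewrite ltr_wpDl// mulr_ge0.
move=> k0 x; have [->|x_neq0] := eqVneq x 0.
  by rewrite partial_sum0 (seminorm0 NP) mulr0.
have d0 : 0 < N x := rnorm_gt0 M x_neq0; set d := N x in d0 *.
have half0 j : 0 < (2^-1 : R) ^+ j by rewrite exprn_gt0// invr_gt0.
have /choice[F FP] : forall zj : X * nat, exists y,
    (forall k, N (S k y) <= L * N zj.1) /\ N (zj.1 - y) < d * (2^-1) ^+ zj.2.+1.
  by move=> [z j]; apply: approx; rewrite mulr_gt0.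
pose rest := fix rest j := if j is l.+1 then rest l - F (rest l, l) else x.
have restN j : N (rest j) <= d * (2^-1) ^+ j.
  case: j => [|j] /=; first by rewrite expr0 mulr1.
  by have [_ /ltW] := FP (rest j, j).
have restS j l k : N (S k (rest j - rest (j + l)%N)) <=
    2 * L * d * ((2^-1) ^+ j - (2^-1) ^+ (j + l)).
  elim: l => [|l IH]; first by rewrite addn0 !subrr partial_sum0 (seminorm0 NP) mulr0.
  rewrite addnS /= opprB addrCA addrC partial_sumD.
  apply: le_trans (seminormD NP _ _) _.
  have := (FP (rest (j + l)%N, (j + l)%N)).1 k => /=.
  have := ler_wpM2l L0 (restN (j + l)%N); rewrite exprS; move: IH; lra.
have restS' j l k : N (S k (rest j - rest (j + l)%N)) <= 2 * L * d * (2^-1) ^+ j.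
  apply: le_trans (restS j l k) _; apply: ler_wpM2l.
    by apply: mulr_ge0 (ltW d0); apply: mulr_ge0.
  by rewrite gerBl ltW.
pose b i j := co (x - rest j) i.
have bE i j l : b i (j + l)%N - b i j = co (rest j - rest (j + l)%N) i.
  by rewrite -coordinatesB opprB addrC -addrA addKr; congr (co _ _); rewrite addrC.
have bN i j l : nu (b i (j + l)%N - b i j) * N (e i) <= 4 * L * d * (2^-1) ^+ j.
  rewrite bE -(seminormZ NP) coordinate_term.
  apply: le_trans (seminormB NP _ _) _.
  by have := restS' j l i.+1; have := restS' j l i; lra.
have /choice[a aP] : forall i, exists l, forall eps : R, 0 < eps ->
    exists m, forall j, (m <= j)%N -> nu (b i j - l) < eps.
  move=> i; apply: modulus_complete => eps eps0.
  have ei : 0 < N (e i) := rnorm_gt0 M (basis_neq0 i).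
  have [j jP] := half_expn_lt (8 * L * d / N (e i)) eps0.
  exists j => j1 j2 /subnKC <- /subnKC <-.
  have h1 := bN i j (j1 - j)%N; have h2 := bN i j (j2 - j)%N.
  rewrite -ler_pdivlMr// in h1; rewrite -ler_pdivlMr// in h2.
  apply: le_lt_trans jP.
  have -> : 8 * L * d / N (e i) * (2^-1) ^+ j =
    4 * L * d * (2^-1) ^+ j / N (e i) + 4 * L * d * (2^-1) ^+ j / N (e i) by ring.
  apply: le_trans (lerD h1 h2).
  have -> : b i (j + (j1 - j))%N - b i (j + (j2 - j))%N =
    (b i (j + (j1 - j))%N - b i j) + - (b i (j + (j2 - j))%N - b i j) by ring.
  by apply: le_trans (modulusD _ _ _) _; rewrite modulusN.
have aS k (eps : R) : 0 < eps ->
    exists m, forall j, (m <= j)%N -> N (psum e a k - S k (x - rest j)) < eps.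
  elim: k eps => [|k IH] eps eps0.
    by exists 0%N => j _; rewrite /partial_sum /psum !big_ord0 subrr (seminorm0 NP).
  have eps2 : 0 < eps / 2 by lra.
  have ek : 0 < N (e k) := rnorm_gt0 M (basis_neq0 k).
  have [m1 m1P] := IH _ eps2; have [m2 m2P] := aP k _ (divr_gt0 eps2 ek).
  exists (maxn m1 m2) => j; rewrite geq_max => /andP[/m1P h1 /m2P h2].
  rewrite /partial_sum /psum !big_ord_recr /= opprD addrACA -scalerBl.
  apply: le_lt_trans (seminormD NP _ _) _; rewrite (seminormZ NP).
  rewrite ltr_pdivlMr// in h2; rewrite -modulusN opprB.
  by move: h1 h2; rewrite /b /partial_sum /psum; lra.
have aSj k j : N (psum e a k - S k (x - rest j)) <= 2 * L * d * (2^-1) ^+ j.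
  apply/ler_addgt0Pr => eps eps0; have [m1 m1P] := aS k _ eps0.
  have := m1P (j + m1)%N (leq_addl _ _); have := restS' j m1 k.
  have -> : psum e a k - S k (x - rest j) = (psum e a k - S k (x - rest (j + m1)%N))
      + S k (rest j - rest (j + m1)%N).
    rewrite !partial_sumB !opprB -[RHS]addrA; congr (_ + _).
    by rewrite [RHS]addrC addrA subrK.
  by have := seminormD NP (psum e a k - S k (x - rest (j + m1)%N))
    (S k (rest j - rest (j + m1)%N)); lra.
have xa : expansion e x a.
  apply/expansionP => eps eps0.
  have eps2 : 0 < eps / 2 by lra.
  have [j jP] := half_expn_lt (d + 2 * L * d) eps2.
  have [m1 m1P] := partial_sum_cvg (x - rest j) eps2.
  exists m1 => k /m1P h1; have h2 := aSj k j; have h3 := restN j.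
  have -> : x - psum e a k = rest j + ((x - rest j) - S k (x - rest j)) -
      (psum e a k - S k (x - rest j)).
    by rewrite opprB addrA -[rest j + _ + _]addrA subrK [rest j + _]addrC subrK.
  have := seminormB NP (rest j + ((x - rest j) - S k (x - rest j)))
    (psum e a k - S k (x - rest j)).
  have := seminormD NP (rest j) ((x - rest j) - S k (x - rest j)).
  by move: jP; rewrite mulrDl; lra.
have := aSj k0 0%N; rewrite /= subrr partial_sum0 subr0 expr0 mulr1.
by rewrite /partial_sum (coordinates_eq xa) => h; move: h d0; lra.
Qed.

End Basis.

(** * Finite and infinite dimension *)

Section Dimension.
Context {K : numFieldType} {X : normedModType K}.
Implicit Types (Y : set X) (b : nat -> X).

Lemma finite_dimensionalP Y : finite_dimensional Y <->
  exists n b, Y = [set psum b c n | c in [set: nat -> K]].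
Proof.
pose ext (T : Type) n (f : 'I_n -> T) (t : T) i := oapp f t (insub i).
have extE T n (f : 'I_n -> T) t i : ext T n f t (val i) = f i by rewrite /ext valK.
split=> [[n [b ->]]|[n [b ->]]].
  exists n, (ext _ n b 0); apply/seteqP; split=> _ [c _ <-].
    by exists (ext _ n c 0) => //; apply: eq_bigr => i _; rewrite !extE.
  by exists (fun i => c i) => //; apply: eq_bigr => i _; rewrite extE.
exists n, (fun i => b i); apply/seteqP; split=> _ [c _ <-]; first by exists (fun i => c i).
by exists (ext _ n c 0) => //; apply: eq_bigr => i _; rewrite extE.
Qed.

Lemma submod_closedP Y : GRing.submod_closed (mem Y) <-> linear_set Y.
Proof.
split=> [[Y0 YD]|[Y0 YD]]; split.
- by move: Y0; rewrite inE.
- by move=> c x y /mem_set Yx /mem_set Yy; have := YD c x y Yx Yy; rewrite inE.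
- by rewrite inE.
- by move=> c x y; rewrite !inE; apply: YD.
Qed.

Lemma psum_recr b c k : psum b c k.+1 = psum b c k + c k *: b k.
Proof. exact: big_ord_recr. Qed.

(** Dropping one functional splits off at most one dimension. *)
Lemma finite_dimensional_functionals (f : nat -> X -> K) m Y : linear_set Y ->
    (forall j c x y, Y x -> Y y -> f j (c *: x + y) = c * f j x + f j y) ->
    (forall y, Y y -> (forall j, (j < m)%N -> f j y = 0) -> y = 0) ->
  finite_dimensional Y.
Proof.
elim: m Y => [|m IH] Y YP fP finj.
  apply/finite_dimensionalP; exists 0%N, (fun=> 0); apply/seteqP; split=> [y Yy|_ [c _ <-]].
    by exists (fun=> 0) => //; rewrite /psum big_ord0 (finj y).
  by rewrite /psum big_ord0; apply: linear_set0.
have f0 j : f j 0 = 0.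
  have := fP j 1 0 0 (linear_set0 YP) (linear_set0 YP); rewrite scale1r mul1r addr0.
  by move/eqP; rewrite -subr_eq0 opprD addNKr oppr_eq0 => /eqP.
pose Y0 := [set y | Y y /\ f m y = 0].
have Y0P : linear_set Y0.
  split; first by split; [exact: linear_set0|exact: f0].
  by move=> c x y [Yx fx] [Yy fy]; split; [exact: YP.2|rewrite fP// fx fy mulr0 addr0].
have /finite_dimensionalP[n [b Y0E]] : finite_dimensional Y0.
  apply: IH => // [j c x y [Yx _] [Yy _]|y [Yy fy] fj]; first exact: fP.
  by apply: finj => // j; rewrite ltnS leq_eqVlt => /predU1P[->|/fj].
have [fm|] := pselect (forall y, Y y -> f m y = 0).
  apply/finite_dimensionalP; exists n, b; rewrite -Y0E.
  by apply/seteqP; split=> y; [move=> Yy; split=> //; exact: fm|case].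
move=> /existsNP[y1 /not_implyP[Yy1 /eqP fy1]].
apply/finite_dimensionalP.
pose b' j := if j == n then y1 else b j.
have b'E c : psum b' c n.+1 = psum b c n + c n *: y1.
  rewrite psum_recr {2}/b' eqxx; congr (_ + _); apply: eq_bigr => i _.
  by rewrite /b' ltn_eqF.
exists n.+1, b'; apply/seteqP; split=> [y Yy|_ [c _ <-]]; last first.
  rewrite b'E; apply: (linear_setD YP); last exact: linear_setZ.
  have : Y0 (psum b c n) by rewrite Y0E; exists c.
  by case.
pose r := f m y / f m y1.
have : Y0 (y - r *: y1).
  split; first by apply: linear_setB => //; apply: linear_setZ.
  by rewrite addrC -scaleNr fP// mulNr /r divfK// addNr.
rewrite Y0E => -[c _ cE].
exists (fun j => if j == n then r else c j) => //.
rewrite b'E eqxx -[RHS](subrK (r *: y1)) -cE; congr (_ + _); apply: eq_bigr => i _.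
by rewrite ltn_eqF.
Qed.

End Dimension.

(** * Isomorphisms given by their graphs *)

Section Graph.
Context {R : realType} {K : numFieldType} (M : real_modulus R K)
  {X : completeNormedModType K}.
Local Notation nu := (modulus M).
Local Notation N := (@rnorm R K M X).
Local Notation NP := (@rnorm_seminorm R K M X).

Definition graph_map (G : set (X * X)) (x : X) : X := xget 0 [set z | G (x, z)].

Definition transpose (G : set (X * X)) : set (X * X) := [set g | G (g.2, g.1)].

Definition bicontinuous (D : R) (G : set (X * X)) : Prop :=
  forall g, G g -> N g.1 <= D * N g.2 /\ N g.2 <= D * N g.1.

Definition sequentially_closed (G : set (X * X)) : Prop := forall x z,
  (forall d : R, 0 < d -> exists g, [/\ G g, N (x - g.1) < d & N (z - g.2) < d]) -> G (x, z).

Lemma transpose_linear G : linear_set G -> linear_set (transpose G).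
Proof. by case=> G0 GD; split=> // c [x1 x2] [y1 y2] /=; apply: GD. Qed.

Lemma transpose_bicontinuous D G : bicontinuous D G -> bicontinuous D (transpose G).
Proof. by move=> GD [x z] /GD[]. Qed.

Lemma transpose_closed G : sequentially_closed G -> sequentially_closed (transpose G).
Proof.
move=> Gc x z h; apply: Gc => d /h[[g1 g2] [Gg h1 h2]].
by exists (g2, g1).
Qed.

Lemma fst_transpose G : fst @` transpose G = snd @` G.
Proof. by apply/seteqP; split=> _ [[g1 g2] Gg <-]; exists (g2, g1). Qed.

Section GraphMap.
Context {D : R} {G : set (X * X)} (GP : linear_set G) (GD : bicontinuous D G).

Lemma fst_linear : linear_set (fst @` G).
Proof.
split; first by exists 0 => //; exact: linear_set0.
move=> c _ _ [g Gg <-] [h Gh <-]; exists (c *: g + h) => //; exact: GP.2.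
Qed.

Lemma graph_unique x z z' : G (x, z) -> G (x, z') -> z = z'.
Proof.
move=> Gz Gz'; have [_] := GD (linear_setB GP Gz Gz').
rewrite /= subrr (seminorm0 NP) mulr0 => h.
by apply/eqP; rewrite -subr_eq0; apply/eqP/(rnorm_eq0 (M := M))/le_anti;
  rewrite h (seminorm_ge0 NP).
Qed.

Lemma graph_mapE x z : G (x, z) -> graph_map G x = z.
Proof. by move=> Gz; apply: xget_unique => // z' Gz'; exact: graph_unique Gz' Gz. Qed.

Lemma graph_map_linear : linear_on (fst @` G) (graph_map G).
Proof.
move=> c _ _ [[x z] Gx <-] [[x' z'] Gx' <-] /=.
rewrite (graph_mapE Gx) (graph_mapE Gx').
by apply: graph_mapE; apply: (GP.2 c _ _ Gx Gx').
Qed.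

Lemma graph_map_continuous : {within fst @` G, continuous (graph_map G)}.
Proof.
have h := @bounded_within_continuous _ _ M _ _ _ fst_linear graph_map_linear D.
apply: h.
by move=> _ [[x z] Gx <-] /=; rewrite (graph_mapE Gx); case: (GD Gx).
Qed.

(** If first components converge then so do the second ones, as [G] is the graph of
    a bounded operator; the limit belongs to the closed set [G]. *)
Lemma fst_closed_subspace : sequentially_closed G -> closed_subspace (fst @` G).
Proof.
move=> Gc; split; last exact/submod_closedP/fst_linear.
apply/(closed_rnormP M) => x xlim.
have half0 j : 0 < (2^-1 : R) ^+ j by rewrite exprn_gt0// invr_gt0.
have /choice[g gP] : forall j : nat, exists g, G g /\ N (x - g.1) < (2^-1) ^+ j.
  by move=> j; have [_ [g Gg <-] xg] := xlim _ (half0 j); exists g.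
have halfle i j : (i <= j)%N -> (2^-1 : R) ^+ j <= (2^-1) ^+ i.
  by move=> ij; apply: ler_wiXn2l; rewrite ?invr_ge0// invf_le1// ler1n.
have [|z zP] := @rnorm_complete _ _ M X (fun j => (g j).2).
  move=> d d0; have [m md] := half_expn_lt (2 * `|D|) d0; exists m => i j mi mj.
  have [_ /=] := GD (linear_setB GP (gP i).1 (gP j).1) => h.
  apply: le_lt_trans h _; apply: le_lt_trans md.
  have := seminormB NP (x - (g j).1) (x - (g i).1).
  rewrite opprB [_ - _ + _]addrC addrA subrK => h1.
  have h2 : N ((g i).1 - (g j).1) <= 2 * (2^-1) ^+ m.
    have := (gP i).2; have := (gP j).2; have := halfle _ _ mi; have := halfle _ _ mj.
    by move: h1; lra.
  apply: le_trans (ler_wpM2r (seminorm_ge0 NP _) (ler_norm D)) _.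
  apply: le_trans (ler_wpM2l (normr_ge0 D) h2) _; lra.
exists (x, z) => //; apply: Gc => d d0.
have [m1 m1P] := zP d d0; have [m2 m2P] := half_expn_lt 1 d0.
exists (g (maxn m1 m2)); split; [exact: (gP _).1| |exact/m1P/leq_maxl].
apply: lt_trans (gP _).2 _; apply: le_lt_trans m2P; rewrite mul1r.
exact/halfle/leq_maxr.
Qed.

End GraphMap.

Lemma graph_isomorphic D G : linear_set G -> bicontinuous D G ->
  isomorphic (fst @` G) (snd @` G).
Proof.
move=> GP GD; have GP' := transpose_linear GP; have GD' := transpose_bicontinuous GD.
exists (graph_map G), (graph_map (transpose G)); split.
- split=> _ [[x z] Gx <-] /=.
    by rewrite (graph_mapE GP GD Gx); exists (x, z).
  by rewrite (@graph_mapE _ _ GP' GD' z x Gx); exists (x, z).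
- split=> _ /set_mem[[x z] Gx <-] /=.
    by rewrite (graph_mapE GP GD Gx) (@graph_mapE _ _ GP' GD' z x Gx).
  by rewrite (@graph_mapE _ _ GP' GD' z x Gx) (graph_mapE GP GD Gx).
- exact: graph_map_linear GP GD.
- exact: graph_map_continuous GP GD.
- by rewrite -fst_transpose; exact: graph_map_continuous GP' GD'.
Qed.

End Graph.

(** * From the space to finitely supported vectors *)

Section Tightness.
Context {R : realType} {K : numFieldType} (M : real_modulus R K)
  {X : completeNormedModType K} {e : nat -> X} (eP : schauder_basis e).
Local Notation nu := (modulus M).
Local Notation N := (@rnorm R K M X).
Local Notation NP := (@rnorm_seminorm R K M X).
Local Notation co := (coordinates e).
Local Notation J := (realize e).
Local Notation n := (fun p => N (J p)).

Lemma coordinate_continuous : exists2 C : R, 0 < C &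
  forall x i, nu (co x i) * N (e i) <= C * N x.
Proof.
have [C C0 CP] := partial_sum_bounded M eP.
exists (2 * C) => [|x i]; first by rewrite mulr_gt0.
rewrite -(seminormZ NP) coordinate_term.
apply: le_trans (seminormB NP _ _) _.
by have := CP i.+1 x; have := CP i x; lra.
Qed.

(** By induction on the number of generators. If a vector [x] involving the last
    generator vanishes at the first [k] coordinates, it serves to eliminate that
    generator, and one nonzero coordinate of [x] has to be added to the first [k]. *)
Lemma finite_dimensional_tail (Y : set X) : finite_dimensional Y ->
  exists k, forall y, Y y -> (forall i, (i < k)%N -> co y i = 0) -> y = 0.
Proof.
move=> /finite_dimensionalP[m [b ->]]; elim: m => [|m [k kP]].
  by exists 0%N => _ [c _ <-] _; rewrite /psum big_ord0.
have [[x [c cx] [xk x0]]|nx] := pselect (exists2 x,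
    exists c, psum b c m.+1 = x & (forall i, (i < k)%N -> co x i = 0) /\ x <> 0); last first.
  exists k => y [c _ cy] yk; apply: contrapT => y0; apply: nx.
  by exists y => //; exists c.
have span c' : [set psum b c m | c in [set: nat -> K]] (psum b c' m) by exists c'.
have cm0 : c m != 0.
  apply: contra_notN x0 => /eqP cm; apply: kP => //.
  by rewrite -cx psum_recr cm scale0r addr0; apply: span.
have [j xj] : exists j, co x j <> 0.
  apply: contrapT => h; apply: x0; apply: (coordinates_eq0 M eP) => j.
  by apply: contrapT => xj; apply: h; exists j.
exists (maxn k j.+1) => _ [c' _ <-] yk; set y := psum b c' m.+1 in yk *.
pose r := c' m / c m.
have yrx : y - r *: x = 0.
  apply: kP.
    rewrite /y -cx !psum_recr scalerDr scalerA /r divfK// opprD addrACA subrr addr0.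
    exists (fun i => - r * c i + c' i) => //.
    by rewrite psum_linear scaleNr addrC.
  move=> i ik; rewrite (coordinatesB M eP) (coordinatesZ M eP) xk// mulr0 subr0.
  by rewrite yk// leq_max ik.
have yE : y = r *: x by apply/eqP; rewrite -subr_eq0 yrx.
have : r * co x j = 0.
  by rewrite -(coordinatesZ M eP) -yE yk// leq_max ltnSn orbT.
by move/eqP; rewrite mulf_eq0 => /orP[/eqP r0|/eqP//]; rewrite yE r0 scale0r.
Qed.

(** The closure of [G] in the product is the graph of an isomorphism between
    closed subspaces; supports do not grow since coordinates are continuous. *)
Lemma tight_by_support_poly : tight_by_support e -> tight_poly n.
Proof.
move=> tight D G GP Grich GD Gdisj.
have nP := @realize_seminorm R K M X e.
have JB p q : J (p - q) = J p - J q.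
  by rewrite addrC -scaleN1r realize_linear scaleN1r addrC.
have [g0 [Gg0 g00 _ _]] := Grich 0%N.
have n0 p : p != 0 -> 0 < n p.
  by move=> p0; apply: rnorm_gt0; apply: contra p0 => /eqP/(realize_eq0 M eP)/eqP.
have D0 : 0 < D.
  have [h _] := GD g0 Gg0; have := n0 _ g00; have := seminorm_ge0 nP g0.2.
  by rewrite /= => h1 h2; rewrite ltNge; apply/negP => D0; move: (lt_le_trans h2 h); nra.
pose H : set (X * X) := [set xz | forall d : R, 0 < d -> exists g,
  [/\ G g, N (xz.1 - J g.1) < d & N (xz.2 - J g.2) < d]].
have GH g : G g -> H (J g.1, J g.2).
  by move=> Gg d d0; exists g; rewrite /= !subrr (seminorm0 NP).
have HP : linear_set H.
  split.
    move=> d d0; exists 0; split; first exact: linear_set0.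
      by rewrite /= /realize /psum size_poly0 big_ord0 subrr (seminorm0 NP).
    by rewrite /= /realize /psum size_poly0 big_ord0 subrr (seminorm0 NP).
  move=> c x y Hx Hy d d0.
  have c1 : 0 < nu c + 1 by rewrite ltr_wpDl ?modulus_ge0.
  have d1 : 0 < d / (nu c + 1) by rewrite divr_gt0.
  have near (x' y' u v : X) : N (x' - u) < d / (nu c + 1) -> N (y' - v) < d / (nu c + 1) ->
      N (c *: x' + y' - (c *: u + v)) < d.
    move=> h1 h2; rewrite opprD addrACA -scalerBr.
    apply: le_lt_trans (seminormD NP _ _) _; rewrite (seminormZ NP).
    rewrite -[ltRHS](divfK (lt0r_neq0 c1)) mulrDr mulr1.
    apply: ler_ltD => //; rewrite mulrC; apply: ler_wpM2r; first exact: modulus_ge0.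
    exact: ltW.
  have [g [Gg g1 g2]] := Hx _ d1; have [h [Gh h1 h2]] := Hy _ d1.
  exists (c *: g + h); split; first exact: GP.2.
    by rewrite [J _](@realize_linear _ _ e c g.1 h.1); apply: near.
  by rewrite [J _](@realize_linear _ _ e c g.2 h.2); apply: near.
have HD : bicontinuous M D H.
  move=> [x z] Hxz; have D1 : 0 < D + 1 by rewrite addr_gt0.
  have near (x' z' u v : X) (d : R) : 0 < d -> N (x' - u) < d / (D + 1) ->
      N (z' - v) < d / (D + 1) -> N u <= D * N v -> N x' <= D * N z' + d.
    move=> d0 h1 h2 h3; have h4 := seminorm_distl NP x' u.
    have h5 := seminorm_distl NP v z'; rewrite (seminormBC NP v) in h5.
    have h6 := ler_wpM2l (ltW D0) h5; have h7 := ler_wpM2l (ltW D0) (ltW h2).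
    rewrite -[in leRHS](divfK (lt0r_neq0 D1) d) mulrDr mulr1 [_ / _ * D]mulrC.
    by move: h1 h3 h4 h6 h7; rewrite mulrDr; lra.
  split=> /=; apply/ler_addgt0Pr => d d0;
    have [g [/GD[/= h1 h2] g1 g2]] := Hxz _ (divr_gt0 d0 D1).
    exact: near d0 g1 g2 h1.
  exact: near d0 g2 g1 h2.
have Hc : sequentially_closed M H.
  move=> x z h d d0; have [|[x' z'] [Hg g1 g2]] := h (d / 2); rewrite ?divr_gt0//.
  have [|g [Gg g1' g2']] := Hg (d / 2); rewrite ?divr_gt0//.
  exists g; split=> //=.
    have := seminormD NP (x - x') (x' - J g.1); rewrite addrA subrK.
    by move: g1 g1' => /=; lra.
  have := seminormD NP (z - z') (z' - J g.2); rewrite addrA subrK.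
  by move: g2 g2' => /=; lra.
have [C C0 CP] := coordinate_continuous.
have limit_coord x i (A : set {poly K}) : (forall p, A p -> p`_i = 0) ->
    (forall d : R, 0 < d -> exists2 p, A p & N (x - J p) < d) -> co x i = 0.
  move=> Ai xA; apply/eqP; rewrite -(modulus_eq0 M) eq_le modulus_ge0 andbT.
  have ei : 0 < N (e i) := rnorm_gt0 M (basis_neq0 M eP i).
  rewrite -(pmulr_lle0 _ ei); apply/ler_addgt0Pr => d d0; rewrite add0r.
  have [|p Ap xp] := xA (d / C); first by rewrite divr_gt0.
  have := CP (x - J p) i; rewrite (coordinatesB M eP) (coordinates_realize M eP) Ai// subr0.
  by move=> /le_trans; apply; rewrite ltr_pdivlMr// mulrC in xp; apply: ltW.
apply: (tight (fst @` H) (snd @` H)).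
- exact: fst_closed_subspace HP HD Hc.
- rewrite -fst_transpose; exact: (fst_closed_subspace (transpose_linear HP)
    (transpose_bicontinuous HD) (transpose_closed Hc)).
- move=> /finite_dimensional_tail[k kP]; have [g [Gg g1 gk _]] := Grich k.
  have /eqP : J g.1 = 0.
    apply: kP => [|i ik]; first by exists (J g.1, J g.2) => //; exact: GH.
    by rewrite (coordinates_realize M eP); move/take_poly_eq0 : gk; apply.
  by apply/negP; apply: contra g1 => /eqP/(realize_eq0 M eP)/eqP.
- move=> /finite_dimensional_tail[k kP]; have [g [Gg g1 _ gk]] := Grich k.
  have Jg2 : J g.2 = 0.
    apply: kP => [|i ik]; first by exists (J g.1, J g.2) => //; exact: GH.
    by rewrite (coordinates_realize M eP); move/take_poly_eq0 : gk; apply.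
  have [+ _] := GD g Gg; rewrite /= Jg2 (seminorm0 NP) mulr0 leNgt.
  by rewrite (n0 _ g1).
- apply/seteqP; split=> // i [[_ [[x z] Hxz <-] /eqP xi] [_ [[x' z'] Hxz' <-] /eqP zi]].
  apply: zi; apply: (limit_coord _ _ (snd @` G)) => [_ [h Gh <-]|d /Hxz'[h [Gh _ h2]]]; last first.
    by exists h.2 => //; exists h.
  apply: contrapT => hi; apply: xi.
  apply: (limit_coord _ _ (fst @` G)) => [_ [g Gg <-]|d /Hxz[g [Gg g1 _]]]; last first.
    by exists g.1 => //; exists g.
  by have [] := Gdisj g h i Gg Gh.
- exact: graph_isomorphic HP HD.
Qed.

End Tightness.

(** * Real and complex scalars *)

Section Scalars.
Context {R : realType}.

Lemma real_net (eps : R) : 0 < eps -> exists s : seq R, forall c, `|c| <= 1 ->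
  exists2 l, l \in s & `|c - l| <= eps.
Proof.
move=> e0; exists [seq i%:R * eps - 1 | i <- iota 0 (Num.truncn (2 / eps)).+1] => c.
rewrite ler_norml => /andP[c1 c2].
have c0 : 0 <= (c + 1) / eps by rewrite divr_ge0 ?(ltW e0)//; lra.
exists ((Num.truncn ((c + 1) / eps))%:R * eps - 1).
  apply: (map_f (fun i : nat => i%:R * eps - 1)).
  rewrite mem_iota /= add0n ltnS; apply: le_truncn.
  by rewrite ler_pM2r ?invr_gt0//; lra.
have /andP[h1 h2] := truncn_itv c0.
rewrite ler_pdivlMr// in h1; rewrite ltr_pdivrMr// -natr1 mulrDl mul1r in h2.
rewrite ler_norml; apply/andP; split; first by lra.
by rewrite lerBlDr; lra.
Qed.

Lemma real_complete (u : nat -> R) :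
  (forall eps : R, 0 < eps -> exists m, forall i j, (m <= i)%N -> (m <= j)%N ->
    `|u i - u j| < eps) ->
  exists l, forall eps : R, 0 < eps -> exists m, forall i, (m <= i)%N -> `|u i - l| < eps.
Proof.
move=> h; have : cvg (u @ \oo).
  apply: cauchy_cvg; apply/cauchy_exP => e e0.
  have [m mP] := h _ e0; exists (u m); exists m => // i mi.
  by rewrite -ball_normE /=; apply: mP.
move=> /cvg_ex[l /cvgrPdist_lt lP]; exists l => eps e0.
have [m _ mP] := lP _ e0; exists m => i mi; rewrite distrC; exact: mP.
Qed.

Definition real_scalars : real_modulus R R.
Proof.
by apply: (@RealModulus R R idfun Num.norm) => //; [exact: real_net|exact: real_complete].
Defined.

Import ComplexField.Normc.

Lemma normc_le (z : R[i]) : normc z <= `|complex.Re z| + `|complex.Im z|.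
Proof.
case: z => a b /=; rewrite -[leRHS]ger0_norm ?addr_ge0//.
rewrite -sqrtr_sqr ler_wsqrtr// sqrrD !real_normK ?num_real//.
by have := mulr_ge0 (normr_ge0 a) (normr_ge0 b); lra.
Qed.

Lemma normc_Re (z : R[i]) : `|complex.Re z| <= normc z.
Proof.
by case: z => a b /=; rewrite -sqrtr_sqr ler_wsqrtr// lerDl sqr_ge0.
Qed.

Lemma normc_Im (z : R[i]) : `|complex.Im z| <= normc z.
Proof.
by case: z => a b /=; rewrite -sqrtr_sqr ler_wsqrtr// lerDr sqr_ge0.
Qed.

Lemma ReB (z w : R[i]) : complex.Re (z - w) = complex.Re z - complex.Re w.
Proof. by case: z; case: w. Qed.

Lemma ImB (z w : R[i]) : complex.Im (z - w) = complex.Im z - complex.Im w.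
Proof. by case: z; case: w. Qed.

Lemma complex_net (eps : R) : 0 < eps -> exists s : seq R[i], forall c, normc c <= 1 ->
  exists2 l, l \in s & normc (c - l) <= eps.
Proof.
move=> e0; have e2 : 0 < eps / 2 by rewrite divr_gt0.
have [s sP] := real_net e2.
exists [seq complex.Complex a b | a <- s, b <- s] => c c1.
have [a sa ac] := sP _ (le_trans (normc_Re c) c1).
have [b sb bc] := sP _ (le_trans (normc_Im c) c1).
exists (complex.Complex a b); first by apply: allpairs_f.
by apply: le_trans (normc_le _) _; rewrite ReB ImB /=; lra.
Qed.

Lemma complex_complete (u : nat -> R[i]) :
  (forall eps : R, 0 < eps -> exists m, forall i j, (m <= i)%N -> (m <= j)%N ->
    normc (u i - u j) < eps) ->
  exists l, forall eps : R, 0 < eps -> exists m, forall i, (m <= i)%N -> normc (u i - l) < eps.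
Proof.
move=> h.
have [|a aP] := @real_complete (fun i => complex.Re (u i)).
  move=> eps /h[m mP]; exists m => i j mi mj; rewrite -ReB.
  exact: le_lt_trans (normc_Re _) (mP _ _ mi mj).
have [|b bP] := @real_complete (fun i => complex.Im (u i)).
  move=> eps /h[m mP]; exists m => i j mi mj; rewrite -ImB.
  exact: le_lt_trans (normc_Im _) (mP _ _ mi mj).
exists (complex.Complex a b) => eps e0; have e2 : 0 < eps / 2 by rewrite divr_gt0.
have [m1 m1P] := aP _ e2; have [m2 m2P] := bP _ e2.
exists (maxn m1 m2) => i; rewrite geq_max => /andP[/m1P h1 /m2P h2].
by apply: le_lt_trans (normc_le _) _; rewrite ReB ImB /=; lra.
Qed.

Definition complex_scalars : real_modulus R R[i].
Proof.
apply: (@RealModulus R R[i] (real_complex R) (@normc R)) => //.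
- exact: lecR.
- exact: complex_net.
- exact: complex_complete.
Defined.

End Scalars.

Lemma real_or_complex_modulus (K : numFieldType) : real_or_complex K ->
  exists R : realType, inhabited (real_modulus R K).
Proof.
by case=> R; exists R; constructor; [exact: real_scalars|exact: complex_scalars].
Qed.

(** * Isomorphisms are almost multiples of the identity somewhere *)

Section AlmostEigenvector.
Context {R : realType} {K : numFieldType} (M : real_modulus R K)
  {X : completeNormedModType K} {e : nat -> X} (eP : schauder_basis e)
  {Y : set X} {T : X -> X} (YP : linear_set Y) (TP : linear_on Y T).
Local Notation nu := (modulus M).
Local Notation N := (@rnorm R K M X).
Local Notation NP := (@rnorm_seminorm R K M X).
Local Notation co := (coordinates e).
Local Notation J := (realize e).
Local Notation S := (partial_sum e).

Lemma linear_on_sum m (c : nat -> K) (w : nat -> X) : (forall j, Y (w j)) ->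
  Y (\sum_(j < m) c j *: w j) /\
  T (\sum_(j < m) c j *: w j) = \sum_(j < m) c j *: T (w j).
Proof.
move=> Yw; elim: m => [|m [IH1 IH2]].
  by rewrite !big_ord0; split; [exact: linear_set0|exact: linear_on0 YP TP].
rewrite !big_ord_recr /= ![_ + c m *: _]addrC; split; first exact: YP.2.
by rewrite TP// IH2.
Qed.

Lemma realize_sum m (c : nat -> K) (v : nat -> {poly K}) :
  J (\sum_(j < m) c j *: v j) = \sum_(j < m) c j *: J (v j).
Proof.
elim: m => [|m IH]; last by rewrite !big_ord_recr /= ![_ + c m *: _]addrC realize_linear IH.
by rewrite !big_ord0 /realize /psum size_poly0 big_ord0.
Qed.

(** Otherwise the first [k] coordinates of [y] and of [T y] would be finitely many
    functionals separating the points of [Y]. *)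
Lemma infinite_dimensional_tail : infinite_dimensional Y -> forall k, exists y,
  [/\ Y y, y <> 0 & forall i, (i < k)%N -> co y i = 0 /\ co (T y) i = 0].
Proof.
move=> Yinf k; apply: contrapT => h; apply: Yinf.
pose f j y := if (j < k)%N then co y j else co (T y) (j - k)%N.
apply: (finite_dimensional_functionals (f := f) (m := (k + k)%N)) => //.
  move=> j c x y Yx Yy; rewrite /f; case: ifP => _; first exact: (coordinates_linear M eP).
  by rewrite TP//; exact: (coordinates_linear M eP).
move=> y Yy fy; apply: contrapT => y0; apply: h; exists y; split=> // i ik.
split; first by have := fy i (ltn_addr _ ik); rewrite /f ik.
have := fy (k + i)%N; rewrite ltn_add2l => /(_ ik).
by rewrite /f ltnNge leq_addr /= addKn.
Qed.

(** Each block is obtained by truncating [y] and [T y], where [y] is a vector of [Y]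
    such that both vanish at all coordinates preceding the block. *)
Lemma approximating_blocks (C eta : R) : 0 < C ->
    (forall k p, N (J (take_poly k p)) <= C * N (J p)) -> 0 < eta ->
    infinite_dimensional Y ->
  exists k u, block_seq k u /\ forall x, lin_span u x -> exists y,
    [/\ Y y, N (y - J x.1) <= eta * N (J x.1) & N (T y - J x.2) <= eta * N (J x.1)].
Proof.
move=> C0 CP eta0 Yinf.
pose Q (a b : nat) (eps : R) (g : {poly K} * {poly K}) := exists y,
  [/\ Y y, N (y - J g.1) <= eps * N (J g.1) & N (T y - J g.2) <= eps * N (J g.1)].
pose d (j : nat) : R := eta / (2 * C) * (2^-1) ^+ j.+1.
have [||k [u [uP /choice[w wP]]]] := @block_seq_exists _ _ Q d.
- by move=> j; apply: weight_gt0.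
- move=> a eps eps0; have [y [Yy /eqP y0 ya]] := infinite_dimensional_tail Yinf a.
  have Ny : 0 < N y := rnorm_gt0 M y0.
  pose d' := Num.min (2^-1) (eps / 2) * N y.
  have d'0 : 0 < d' by rewrite mulr_gt0// lt_min invr_gt0 ltr0n divr_gt0.
  have [m1 m1P] := partial_sum_cvg M eP y d'0.
  have [m2 m2P] := partial_sum_cvg M eP (T y) d'0.
  pose b := maxn a.+1 (maxn m1 m2).
  have [ab bm1 bm2] : [/\ a < b, m1 <= b & m2 <= b]%N.
    by rewrite /b !leq_max !leqnn !orbT.
  have h1 := m1P b bm1; have h2 := m2P b bm2.
  have J1 z : J (\poly_(i < b) co z i) = S b z by rewrite realize_poly.
  have d'1 : d' <= 2^-1 * N y by rewrite ler_pM2r// ge_min lexx.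
  have d'2 : d' <= eps / 2 * N y by rewrite ler_pM2r// ge_min lexx orbT.
  have hS : N y <= 2 * N (S b y).
    by have := seminorm_distl NP y (S b y); move: h1 d'1; lra.
  have d'S : d' <= eps * N (S b y).
    apply: le_trans d'2 _; rewrite -mulrA ler_pM2l// mulrC; move: hS; lra.
  have blk z : (forall i, (i < a)%N -> co z i = 0) -> block a b (\poly_(i < b) co z i).
    move=> za i /orP[ia|bi]; rewrite coef_poly; first by rewrite za// if_same.
    by rewrite ltnNge bi.
  exists b, (\poly_(i < b) co y i, \poly_(i < b) co (T y) i); split => //=.
  + by apply: blk => i /ya[].
  + by apply: blk => i /ya[].
  + apply: contraTneq Ny => p0; rewrite -leNgt; apply: le_trans hS _.
    by rewrite -J1 p0 /realize /psum size_poly0 big_ord0 (seminorm0 NP) mulr0.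
  + by exists y; rewrite /= !J1; split=> //; apply: le_trans (ltW _) d'S.
have Yw j : Y (w j) by case: (wP j).
exists k, u; split=> // x [m [c ->]]; exists (\sum_(j < m) c j *: w j).
have [Ysum Tsum] := linear_on_sum m c Yw; rewrite Tsum.
have le (z : nat -> X) (v : nat -> {poly K}) :
    (forall j, N (z j - J (v j)) <= d j * N (J (u j).1)) ->
    N (\sum_(j < m) c j *: z j - J (\sum_(j < m) c j *: v j)) <=
      eta * N (J (\sum_(j < m) c j *: (u j).1)).
  move=> zP; rewrite -sum1E realize_sum -sumrB.
  under eq_bigr => j _ do rewrite -scalerBr.
  apply: le_trans (seminorm_sum NP _ _ _) _.
  under eq_bigr => j _ do rewrite (seminormZ NP).
  exact: (block_sum_le (@realize_seminorm R K M X e) C0 CP uP m c (ltW eta0) zP).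
split=> //.
  by rewrite sum1E; apply: (le w (fun j => (u j).1)) => j; case: (wP j).
by rewrite sum1E sum2E; apply: (le (T \o w) (fun j => (u j).2)) => j; case: (wP j).
Qed.

(** For small [eta], the span of approximating blocks is still the graph of an
    isomorphism, so it contains a pair with nearly proportional components, and the
    vector of [Y] that this pair approximates inherits the proportionality. *)
Theorem almost_eigenvector (D : R) : tight_by_support e -> infinite_dimensional Y ->
    0 < D -> (forall y, Y y -> N (T y) <= D * N y /\ N y <= D * N (T y)) ->
  forall eps : R, 0 < eps -> exists y lam, [/\ Y y, y != 0 & N (T y - lam *: y) <= eps * N y].
Proof.
move=> tight Yinf D0 TD eps eps0.
have [C C0 CP] := partial_sum_bounded M eP.
have n_take k p : N (J (take_poly k p)) <= C * N (J p).
  by rewrite (realize_take M eP).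
have n_eq0 (p : {poly K}) : N (J p) = 0 -> p = 0.
  by move/rnorm_eq0/(realize_eq0 M eP).
pose D' := 2 * D + 2.
have D'0 : 0 < D' by rewrite /D'; lra.
pose eta := Num.min (2 * (1 + D))^-1 (eps / (8 * (D' + 2))).
have D'2 : 0 < 8 * (D' + 2) by lra.
have D1 : 0 < 2 * (1 + D) by lra.
have eta0 : 0 < eta by rewrite lt_min invr_gt0 D1 divr_gt0.
have etaD : eta * (1 + D) <= 2^-1.
  suff : eta * (2 * (1 + D)) <= 1 by lra.
  by rewrite -ler_pdivlMr// div1r ge_min lexx.
have etaeps : eta * (8 * (D' + 2)) <= eps.
  by rewrite -ler_pdivlMr// ge_min lexx orbT.
have eta2 : eta <= 2^-1 by have := mulr_gt0 eta0 D0; move: etaD; lra.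
have [k [u [uP uY]]] := approximating_blocks C0 n_take eta0 Yinf.
have uD : comparable_on (fun p => N (J p)) D' (lin_span u).
  move=> x /uY[y [Yy h1 h2]]; have [h3 h4] := TD y Yy.
  have n1 := seminorm_ge0 NP (J x.1); have n2 := seminorm_ge0 NP (J x.2).
  have e1 := seminorm_distl NP (J x.2) (T y); rewrite (seminormBC NP) in e1.
  have e2 := seminorm_distl NP y (J x.1).
  have e3 := seminorm_distl NP (J x.1) y; rewrite (seminormBC NP) in e3.
  have e4 := seminorm_distl NP (T y) (J x.2).
  have etaN := ler_wpM2r n1 etaD.
  have De2 := ler_wpM2l (ltW D0) (le_trans e2 (lerD h1 (lexx _))).
  have De4 := ler_wpM2l (ltW D0) (le_trans e4 (lerD h2 (lexx _))).
  rewrite mulrDr in De2; rewrite mulrDr in De4; rewrite mulrDr mulr1 mulrDl in etaN.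
  have Dn1 := mulr_ge0 (ltW D0) n1; have Dn2 := mulr_ge0 (ltW D0) n2.
  rewrite /D'; split; lra.
pose eps1 := Num.min 1 (eps / 4).
have eps10 : 0 < eps1 by rewrite lt_min ltr01 divr_gt0.
have eps11 : eps1 <= 1 by rewrite ge_min lexx.
have eps14 : eps1 <= eps / 4 by rewrite ge_min lexx orbT.
have [x [lam [xu x0 xlam]]] := block_seq_almost_proportional
  (@realize_seminorm R K M X e) n_eq0 C0 n_take (tight_by_support_poly eP tight)
  uP D'0 uD eps10.
have [y [Yy h1 h2]] := uY x xu; have [_ xD] := uD x xu.
have Jx0 : 0 < N (J x.1).
  by apply: rnorm_gt0; apply: contra x0 => /eqP/(realize_eq0 M eP)/eqP.
set n1 := N (J x.1) in h1 h2 xD xlam Jx0.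
have xlam' : N (J x.2 - lam *: J x.1) <= eps1 * n1.
  move: xlam; rewrite (_ : J (x.2 - lam *: x.1) = J x.2 - lam *: J x.1)//.
  by rewrite addrC -scaleNr realize_linear scaleNr addrC.
have lamD : nu lam <= D' + 1.
  rewrite -(ler_pM2r Jx0) -(seminormZ NP).
  have := seminorm_distl NP (lam *: J x.1) (J x.2); rewrite (seminormBC NP).
  have := ler_wpM2r (ltW Jx0) eps11; move: xlam' xD; lra.
have n1y : n1 <= 2 * N y.
  have := seminorm_distl NP (J x.1) y; rewrite (seminormBC NP) -/n1.
  have := ler_wpM2r (ltW Jx0) eta2; move: h1; lra.
exists y, lam; split=> //.
  by apply: contraTneq n1y => ->; rewrite (seminorm0 NP) mulr0 -ltNge.
have -> : T y - lam *: y = (T y - J x.2) + (J x.2 - lam *: J x.1) - lam *: (y - J x.1).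
  by rewrite addrA subrK scalerBr opprB addrA subrK.
apply: le_trans (seminormB NP _ _) _; rewrite (seminormZ NP).
have := seminormD NP (T y - J x.2) (J x.2 - lam *: J x.1).
have e1 : nu lam * N (y - J x.1) <= (D' + 1) * (eta * n1).
  by apply: ler_pM => //; [exact: modulus_ge0|exact: seminorm_ge0 NP _].
have e2 := ler_wpM2r (ltW Jx0) etaeps; have e3 := ler_wpM2r (ltW Jx0) eps14.
have e4 := ler_wpM2l (ltW eps0) n1y.
have e5 := mulr_ge0 (ltW eps0) (seminorm_ge0 NP y).
by move: h2 xlam' e1 e2 e3 e4 e5; lra.
Qed.

End AlmostEigenvector.

Section Angle.
Context {R : realType} {K : numFieldType} (M : real_modulus R K) {X : normedModType K}.
Local Notation iota := (of_real M).
Local Notation N := (@rnorm R K M X).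
Local Notation NP := (@rnorm_seminorm R K M X).

Definition normalize (x : X) : X := (iota (N x))^-1 *: x.

Lemma norm_normalize x : x != 0 -> `|normalize x| = 1.
Proof.
move=> x0; have Nx := rnorm_gt0 M x0.
rewrite (rnormE M) (seminormZ NP) modulusV modulus_of_real ?(ltW Nx)//.
by rewrite mulVf ?gt_eqF// rmorph1.
Qed.

(** [normalize x - normalize y] is [x - y] divided by the norm of [y], up to a vector
    whose norm is the difference of the norms divided by that of [y]. *)
Lemma normalize_dist x y : x != 0 -> y != 0 ->
  N (normalize x - normalize y) <= 2 * N (x - y) / N y.
Proof.
move=> x0 y0; have Nx := rnorm_gt0 M x0; have Ny := rnorm_gt0 M y0.
have ix : iota (N x) != 0 by rewrite fmorph_eq0 gt_eqF.
have iy : iota (N y) != 0 by rewrite fmorph_eq0 gt_eqF.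
have -> : normalize x - normalize y = (iota (N y))^-1 *: ((x - y) +
    (iota (N y) - iota (N x)) *: normalize x).
  have E : (iota (N y))^-1 *: ((iota (N y) - iota (N x)) *: normalize x) =
      normalize x - (iota (N y))^-1 *: x.
    rewrite scalerA mulrBr mulVf// scalerBl scale1r; congr (_ - _).
    by rewrite /normalize scalerA -mulrA divff// mulr1.
  by rewrite scalerDr E scalerBr [RHS]addrC addrA subrK.
rewrite (seminormZ NP) modulusV modulus_of_real ?(ltW Ny)// mulrC.
apply: ler_wpM2r; first by rewrite invr_ge0 ltW.
apply: le_trans (seminormD NP _ _) _; rewrite (seminormZ NP).
have -> : N (normalize x) = 1.
  by apply: (@of_real_inj _ _ M); rewrite -rnormE norm_normalize// rmorph1.
rewrite mulr1; suff : modulus M (iota (N y) - iota (N x)) <= N (x - y) by lra.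
have h1 := seminorm_distl NP x y; have h2 := seminorm_distl NP y x.
rewrite (seminormBC NP y) in h2; rewrite -rmorphB.
have [yx|xy] := leP (N x) (N y).
  by rewrite modulus_of_real ?subr_ge0//; lra.
by rewrite -modulusN -rmorphN opprB modulus_of_real ?subr_ge0 ?(ltW xy)//; lra.
Qed.

End Angle.

(* [infimums A] is the set of greatest lower bounds of [A]; it is used instead
   of [inf] because the norms take values in [K], which may be complex. *)
Theorem corollary1p6 (K : numFieldType) (hK : real_or_complex K)
    (X : completeNormedModType K) (e : nat -> X)
    (e_basis : schauder_basis e) (e_tight : tight_by_support e)
    (Y Z : set X)
    (Y_sub : closed_subspace Y) (Z_sub : closed_subspace Z)
    (Y_inf : infinite_dimensional Y) (Z_inf : infinite_dimensional Z)
    (YZ_iso : isomorphic Y Z) :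
  infimums [set r : K | exists y z : X,
    [/\ Y y, Z z, `|y| = 1, `|z| = 1 & r = `|y - z|]] 0.
Proof.
have [R [M]] := real_or_complex_modulus hK.
have [Y_closed /submod_closedP YP] := Y_sub; have [Z_closed /submod_closedP ZP] := Z_sub.
have [T [S [[YT ZS] [TK SK] TP Tcont Scont]]] := YZ_iso.
have TZ y : Y y -> Z (T y) by move/YT.
have SY z : Z z -> Y (S z) by move/ZS.
have TK' y : Y y -> S (T y) = y by move=> Yy; apply: TK; rewrite inE.
have SK' z : Z z -> T (S z) = z by move=> Zz; apply: SK; rewrite inE.
have SP : linear_on Z S.
  move=> c z z' Zz Zz'; rewrite -{1}(SK' z Zz) -{1}(SK' z' Zz') -TP; [|exact: SY..].
  by rewrite TK'//; apply: YP.2; exact: SY.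
have [D1 D10 D1P] := within_continuous_bounded M YP TP Tcont.
have [D2 D20 D2P] := within_continuous_bounded M ZP SP Scont.
pose D := D1 + D2; have D0 : 0 < D by rewrite addr_gt0.
have NP := @rnorm_seminorm _ _ M X.
have TD y : Y y -> rnorm M (T y) <= D * rnorm M y /\ rnorm M y <= D * rnorm M (T y).
  move=> Yy; have h1 := D1P y Yy; have := D2P (T y) (TZ y Yy); rewrite TK'// => h2.
  have := mulr_ge0 (ltW D10) (seminorm_ge0 NP (T y)).
  have := mulr_ge0 (ltW D20) (seminorm_ge0 NP y).
  by rewrite /D; split; lra.
have close (d : R) : 0 < d -> exists y z, [/\ Y y, Z z, `|y| = 1, `|z| = 1 &
    rnorm M (y - z) < d].
  move=> d0; (* The first bound keeps [lam *: y] away from 0, the second one makes the normalized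
     vectors [d]-close. *)
  pose eps := Num.min (2 * D)^-1 (d / (4 * D)).
  have eps0 : 0 < eps by rewrite lt_min invr_gt0 !divr_gt0 ?mulr_gt0.
  have eps1 : eps * (2 * D) <= 1 by rewrite -ler_pdivlMr ?mulr_gt0// div1r ge_min lexx.
  have eps2 : eps * (4 * D) <= d by rewrite -ler_pdivlMr ?mulr_gt0// ge_min lexx orbT.
  have [y [lam [Yy y0 h]]] := almost_eigenvector e_basis YP TP e_tight Y_inf D0 TD eps0.
  have [_ yD] := TD y Yy; have Ny := rnorm_gt0 M y0.
  have NT : 0 < rnorm M (T y).
    by rewrite -(pmulr_rgt0 _ D0); apply: lt_le_trans yD.
  have Ty0 : T y != 0 by apply: contraTneq NT => ->; rewrite (seminorm0 NP) ltxx.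
  have epsy : eps * rnorm M y <= 2^-1 * rnorm M (T y).
    have := ler_wpM2l (ltW eps0) yD; have := ler_wpM2r (ltW NT) eps1; lra.
  have epsd : eps * rnorm M y <= d / 4 * rnorm M (T y).
    have := ler_wpM2l (ltW eps0) yD; have := ler_wpM2r (ltW NT) eps2; lra.
  have ly0 : lam *: y != 0.
    apply/eqP => ly; move: h; rewrite ly subr0; lra.
  exists (normalize M (lam *: y)), (normalize M (T y)); split.
  - by apply: linear_setZ => //; apply: linear_setZ.
  - by apply: linear_setZ => //; apply: TZ.
  - exact: norm_normalize.
  - exact: norm_normalize.
  - apply: le_lt_trans (normalize_dist M ly0 Ty0) _; rewrite ltr_pdivrMr//.
    rewrite (seminormBC NP); have := mulr_gt0 d0 NT; lra.
split=> [_ [y [z [_ _ _ _ ->]]]|t tlow]; first exact: normr_ge0.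
have tle y z : Y y -> Z z -> `|y| = 1 -> `|z| = 1 -> t <= `|y - z|.
  by move=> Yy Zz y1 z1; apply: tlow; exists y, z.
have t_real : t \is Num.real.
  have [y [z [Yy Zz y1 z1 _]]] := close 1 ltr01.
  by rewrite (ler_real (tle y z Yy Zz y1 z1)) normr_real.
rewrite real_leNgt ?real0//; apply/negP => /(gt0_of_real M)[d d0 tE].
have [y [z [Yy Zz y1 z1]]] := close d d0.
rewrite -(norm_lt_of_real M) -tE => lt_t.
by have := lt_le_trans lt_t (tle y z Yy Zz y1 z1); rewrite ltxx.
Qed.
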